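(* Let $E$ be an infinite dimensional separable (real) Banach space, $\mu$ a centered Gaussian probability on $E$, and $\mathcal H\subset E$ the Reproducing Kernel Hilbert Space (RKHS) of $\mu$. Then there exist infinitely many distinct intermediate spaces between $E$ and $\mathcal H$.
   Context: $E'$ denotes the topological dual of $E$. Each $\xi\in E'$ is regarded as the random variable $x\mapsto\langle\xi,x\rangle$ on $(E,\mu)$, and $E'_\mu$ denotes the completion (closure) of $E'$ in $L^2(\mu)$. The RKHS $\mathcal H$ of $\mu$ is the space of vectors $h=\int_E x\,g(x)\,d\mu(x)\in E$, $g\in E'_\mu$, endowed with the scalar product $\langle h_1,h_2\rangle_{\mathcal H}=\int_E g_1g_2\,d\mu$ for $h_i=\int_E x\,g_i(x)\,d\mu(x)$. An intermediate space is a separable Banach space $\widetilde E$ with $\mathcal H\subset\widetilde E\subset E$ (as linear subspaces, $\widetilde E$ carrying its own Banach norm) such that $\mu(\widetilde E)=1$ and the embeddings (inclusion maps) $\mathcal H\hookrightarrow\widetilde E$ and $\widetilde E\hookrightarrow E$ are compact. *)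

(* Defs.v *)
From HB Require Import structures.
From mathcomp Require Import all_boot all_order all_algebra.
From mathcomp Require Import all_classical all_reals all_analysis.

Set Implicit Arguments.
Unset Strict Implicit.
Unset Printing Implicit Defensive.

Import Order.TTheory GRing.Theory Num.Theory.
Import numFieldNormedType.Exports.

Local Open Scope classical_set_scope.
Local Open Scope ring_scope.

Definition separable_space (T : topologicalType) : Prop :=
  exists2 D : set T, countable D & dense D.

Definition infinite_dimensional (R : realType) (V : lmodType R) : Prop :=
  forall (n : nat) (v : 'I_n -> V),
    exists x : V, forall c : 'I_n -> R, x <> \sum_(i < n) c i *: v i.

Notation borel T := (g_sigma_algebraType (@open T)).

Section bochner.
Context d (T : measurableType d) (R : realType) (V : completeNormedModType R).
Variable mu : {measure set T -> \bar R}.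

Definition simple_function (s : T -> V) : Prop :=
  finite_set (range s) /\ forall v, measurable (s @^-1` [set v]).

Definition simple_integral (s : T -> V) : V :=
  \sum_(v \in range s) fine (mu (s @^-1` [set v])) *: v.

(* [y] is the Bochner integral of [f]; only used below for finite [mu]. *)
Definition is_bochner_integral (f : T -> V) (y : V) : Prop :=
  exists s : nat -> T -> V,
    [/\ forall n, simple_function (s n),
        {ae mu, forall x, (fun n => s n x) @ \oo --> f x},
        (fun n => (\int[mu]_x (`|f x - s n x|)%:E)%E) @ \oo --> 0%E &
        (fun n => simple_integral (s n)) @ \oo --> y].

End bochner.

Section gaussian.
Context (R : realType) (E : completeNormedModType R).
Variable mu : probability (borel E) R.

(* The centered normal law of standard deviation [s]; the case [s = 0] must be
   treated apart because [normal_prob 0 0] is not the Dirac mass at [0]. *)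
Definition centered_normal (s : R) (B : set R) : \bar R :=
  if s == 0 then \d_(0 : R) B else normal_prob 0 s B.

Definition centered_gaussian : Prop :=
  forall xi : {linear E -> R^o}, continuous xi ->
    exists2 s : R, 0 <= s &
      forall B : set R, measurable B -> mu (xi @^-1` B) = centered_normal s B.

(* The closure of the topological dual in [L^2(mu)]; its elements are given by
   their representatives, i.e. functions rather than classes modulo [mu]-a.e.
   equality. *)
Definition dual_L2_closure : set (borel E -> R) :=
  [set g | g \in Lfun mu 2%:E /\
    forall e : R, 0 < e ->
      exists2 xi : {linear E -> R^o}, continuous xi &
        ('N[mu]_2%:E [EFin \o (fun x => g x - xi x)%R] < e%:E)%E].

Definition rkhs_repr (h : E) : set (borel E -> R) :=
  [set g | dual_L2_closure g /\
           is_bochner_integral mu (fun x : borel E => g x *: (x : E)) h].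

Definition rkhs : set E := [set h | rkhs_repr h !=set0].

(* Two representatives of the same [h] are [mu]-a.e. equal, so the value does
   not depend on those selected by [xget]. *)
Definition rkhs_dot (h1 h2 : E) : R :=
  \int[mu]_x (xget (cst 0) (rkhs_repr h1) x * xget (cst 0) (rkhs_repr h2) x).

Definition rkhs_norm (h : E) : R := Num.sqrt (rkhs_dot h h).

(* The linear subspace [F] of [E] can be endowed with a norm making it an
   intermediate space. The normed space [F] is presented as a Banach space [V]
   with an injective linear map [j] of image [F], which plays the role of the
   inclusion; a subset [A] of [F], seen in [V], is then [j @^-1` A]. *)
Definition intermediate_space (F : set E) : Prop :=
  exists (V : completeNormedModType R) (j : {linear V -> E}),
    [/\ injective j,
        range j = F &
        separable_space V] /\
    [/\ rkhs `<=` F,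
        measurable (F : set (borel E)),
        mu F = 1%E,
        (forall A : set E, A `<=` rkhs ->
           (exists M : R, forall h, A h -> rkhs_norm h <= M) ->
           precompact (j @^-1` A)) &
        (forall A : set V, bounded_set A -> precompact (j @` A))].

End gaussian.

(* Main.v *)
(** Choose, by tightness, a compact absolutely convex [B] such that
[\bigcup_n n B] has full measure.  The Davis-Figiel-Johnson-Pelczynski disc
[C = \bigcap_n (2^n B + 2^-n U)], with [U] the unit ball, is again compact, and
[B] is compact for the gauge of [C]; hence the closure [F] of the span of [B]
for this gauge is a separable Banach space, compactly embedded in [E] and of
full measure.

No integration in [F] is needed to see that the RKHS embeds compactly in [F].
If [A] is closed, absolutely convex and [mu A >= 3/4], a functional [xi] with
[`|xi| <= 1] on [A] has a standard deviation bounded by a universal constant,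
so that [xi h = \int g xi dmu] is bounded on the unit ball of the RKHS; by
Hahn-Banach this ball is contained in a multiple of [A].  Taking for [A] a
multiple of [B], the ball is relatively compact in [F].

An intermediate space is never equal to [E], because by Baire and Riesz an
infinite dimensional [E] is not the range of a compact operator.  Since [B] may
be required to contain finitely many prescribed points, no finite list of
intermediate spaces [F_i] is exhaustive: prescribe a point outside each
[F_i]. *)
Require Import Defs.
From HB Require Import structures.
From mathcomp Require Import all_boot all_order all_algebra.
From mathcomp Require Import all_classical all_reals all_analysis.
From mathcomp Require Import finmap measurable_realfun ring lra.

Import Order.TTheory GRing.Theory Num.Theory.
Import numFieldNormedType.Exports.

Set Implicit Arguments.
Unset Strict Implicit.
Unset Printing Implicit Defensive.

Local Open Scope classical_set_scope.
Local Open Scope ring_scope.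

(** * Compactness and total boundedness *)

Section total_boundedness.
Context (R : realType).

Definition has_finite_nets (E : normedModType R) (A : set E) : Prop :=
  forall e : R, 0 < e ->
    exists s : seq E, forall x, A x -> exists2 y, y \in s & `|x - y| <= e.

Lemma compact_finite_net (E : normedModType R) (A : set E) (e : R) :
  compact A -> 0 < e ->
  exists2 s : seq E, [set` s] `<=` A &
    forall x, A x -> exists2 y, y \in s & `|x - y| <= e.
Proof.
rewrite compact_cover => cA e0.
have [x Ax|x Ax|D DA Dcov] := cA E A (fun x => ball x e).
- exact: ball_open.
- by exists x => //; exact: ballxx.
exists (enum_fset D) => [x xD|x /Dcov[y yD]]; first exact/set_mem/DA.
rewrite -ball_normE /= => /ltW yxe; exists y => //.
by rewrite distrC.
Qed.

Lemma compact_has_finite_nets (E : normedModType R) (A : set E) :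
  compact A -> has_finite_nets A.
Proof. by move=> cA e /(compact_finite_net cA)[s _ sA]; exists s. Qed.

(** An ultrafilter on [A] contains, for every radius, one of the finitely many balls of a net, so it
    is Cauchy; completeness gives its limit, which closedness keeps in [A]. *)
Lemma finite_nets_compact (E : completeNormedModType R) (A : set E) :
  closed A -> has_finite_nets A -> compact A.
Proof.
move=> clA netA; rewrite compact_ultra => F FU FA.
have PF : ProperFilter F by exact: ultra_proper.
suff /cauchy_cvg Fcvg : cauchy F.
  exists (lim F); split=> //.
  exact: (@closed_cvg _ _ F PF id A clA FA (lim F) Fcvg).
apply/cauchyP => e e0.
have e20 : 0 < e / 2 by rewrite divr_gt0.
have [s As] := netA _ e20.
suff [y ys Fy] : exists2 y, y \in s & F [set x | `|x - y| <= e / 2].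
  exists y; apply: filterS Fy => x /= xy.
  rewrite -ball_normE /= distrC (le_lt_trans xy)//.
  by rewrite ltr_pdivrMr// mulr_natr mulr2n ltrDl.
(* Either the ultrafilter contains the ball about [y], or it contains the part of [A] outside that
   ball, which the other centres still cover. *)
elim: s A {clA netA} FA As => [|y s IH] A FA As.
  have [x Ax] := filter_ex FA.
  by have [y] := As x Ax; rewrite in_nil.
have [Fy|FCy] := in_ultra_setVsetC [set x | `|x - y| <= e / 2] FU.
  by exists y => //; rewrite mem_head.
have [|x [Ax /= Nxy]|z zs Fz] := IH (A `&` ~` [set x | `|x - y| <= e / 2]).
- exact: filterI.
- have [z] := As x Ax; rewrite in_cons => /predU1P[->//|zs xz].
  by exists z.
- by exists z => //; rewrite in_cons zs orbT.
Qed.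

Lemma sub_compact_precompact (E : normedModType R) (A K : set E) :
  compact K -> A `<=` K -> precompact A.
Proof.
move=> cK AK; apply: precompact_subset AK _.
by apply: compact_precompact => //; exact: norm_hausdorff.
Qed.

(** The set is the sum of [K] and [C]. When [x] is outside it, [x - k] stays outside [C] under small
    changes of [x], uniformly in [k] by compactness of [K]. *)
Lemma closed_compactD (E : normedModType R) (K C : set E) :
  compact K -> closed C -> closed [set x | exists2 k, K k & C (x - k)].
Proof.
move=> /compact_near_coveringP cK clC; rewrite -[X in closed X]setCK.
apply: open_closedC; rewrite openE => x /= Nx.
have : \forall x' \near x, K `<=` (fun k => ~ C (x' - k)).
  apply: (cK E (nbhs x) (fun x' k => ~ C (x' - k))) => k Kk.
  have : nbhs (x - k) (~` C).
    apply: open_nbhs_nbhs; split; first exact: closed_openC.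
    by move=> Cxk; apply: Nx; exists k.
  move=> NC.
  have : (z.2 - z.1) @[z --> (k, x)] --> x - k.
    by apply: cvgB; [exact: cvg_snd|exact: cvg_fst].
  by move=> /(_ _ NC).
by apply: filterS => y Hy [k Kk]; exact: Hy.
Qed.

End total_boundedness.

(** * Absolutely convex sets *)

Section absolutely_convex_sets.
Context (R : realType).

Definition absolutely_convex (E : lmodType R) (A : set E) : Prop :=
  A 0 /\ forall (a b : R) x y,
    A x -> A y -> `|a| + `|b| <= 1 -> A (a *: x + b *: y).

Definition dilate (E : lmodType R) (t : R) (A : set E) : set E :=
  [set t *: x | x in A].

Section algebra.
Context (E : lmodType R) (A : set E).
Hypothesis cA : absolutely_convex A.

Lemma absolutely_convexZ a x : `|a| <= 1 -> A x -> A (a *: x).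
Proof.
move=> a1 Ax; have [A0 Ac] := cA.
by have := Ac a 0 _ _ Ax A0; rewrite scaler0 addr0 normr0 addr0; apply.
Qed.

Lemma dilate0 t : dilate t A 0.
Proof. by exists 0; rewrite ?scaler0//; case: cA. Qed.

Lemma dilateZ s t x : dilate t A x -> dilate (s * t) A (s *: x).
Proof. by move=> [y Ay <-]; exists y => //; rewrite scalerA. Qed.

Lemma dilate_le s t : `|s| <= t -> dilate s A `<=` dilate t A.
Proof.
move=> st _ [x Ax <-]; have [t0|t0] := eqVneq t 0.
  move: st; rewrite t0 normr_le0 => /eqP ->; rewrite scale0r.
  exact: dilate0.
have tgt0 : 0 < t by rewrite lt_neqAle eq_sym t0 (le_trans _ st).
exists ((s / t) *: x); last by rewrite scalerA mulrC divfK.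
apply: absolutely_convexZ => //.
by rewrite normrM normfV (gtr0_norm tgt0) ler_pdivrMr// mul1r.
Qed.

Lemma dilateD s t x y : 0 <= s -> 0 <= t ->
  dilate s A x -> dilate t A y -> dilate (s + t) A (x + y).
Proof.
move=> s0 t0 [x' Ax <-] [y' Ay <-]; have [st0|st0] := eqVneq (s + t) 0.
  have /eqP s00 : s == 0 by rewrite eq_le s0 andbT -st0 lerDl.
  have /eqP t00 : t == 0 by rewrite eq_le t0 andbT -st0 lerDr.
  by rewrite s00 t00 !scale0r !addr0; exact: dilate0.
have stgt0 : 0 < s + t by rewrite lt_neqAle eq_sym st0 addr_ge0.
exists ((s / (s + t)) *: x' + (t / (s + t)) *: y').
  apply: (proj2 cA) => //.
  by rewrite !ger0_norm ?divr_ge0 ?addr_ge0// -mulrDl divff.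
by rewrite scalerDr !scalerA !(mulrC (s + t)) !divfK.
Qed.

Lemma dilateN t x : dilate t A x -> dilate t A (- x).
Proof.
move=> [y Ay <-]; exists (- y); last by rewrite scalerN.
by rewrite -scaleN1r; apply: absolutely_convexZ; rewrite ?normrN1.
Qed.

Lemma dilateB s t x y : 0 <= s -> 0 <= t ->
  dilate s A x -> dilate t A y -> dilate (s + t) A (x - y).
Proof. by move=> s0 t0 Ax /dilateN; exact: dilateD. Qed.

Lemma absolutely_convex_dilate t : absolutely_convex (dilate t A).
Proof.
split=> [|a b _ _ [x Ax <-] [y Ay <-] ab]; first exact: dilate0.
exists (a *: x + b *: y); first exact: (proj2 cA).
by rewrite scalerDr !scalerA ![_ * t]mulrC.
Qed.

Lemma dilate1 : dilate 1 A = A.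
Proof.
apply/seteqP; split=> [_ [x Ax <-]|x Ax]; first by rewrite scale1r.
by exists x; rewrite ?scale1r.
Qed.

Lemma dilateE t x : t != 0 -> dilate t A x <-> A (t^-1 *: x).
Proof.
move=> t0; split=> [[y Ay <-]|Ax]; first by rewrite scalerA mulVf// scale1r.
by exists (t^-1 *: x); rewrite // scalerA mulfV// scale1r.
Qed.

End algebra.

Lemma dilateM (E : lmodType R) (A : set E) s t x :
  dilate s (dilate t A) x <-> dilate (s * t) A x.
Proof.
split=> [[_ [y Ay <-] <-]|[y Ay <-]]; first by exists y; rewrite // scalerA.
by exists (t *: y); [exists y|rewrite scalerA].
Qed.

Definition thicken (E : normedModType R) (e : R) (A : set E) : set E :=
  [set x | exists2 y, A y & `|x - y| <= e].

Lemma absolutely_convex_thicken (E : normedModType R) (e : R) (A : set E) :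
  0 <= e -> absolutely_convex A -> absolutely_convex (thicken e A).
Proof.
move=> e0 [A0 Ac]; split=> [|a b x y [x' Ax xx'] [y' Ay yy'] ab].
  by exists 0; rewrite ?subrr ?normr0.
exists (a *: x' + b *: y'); first exact: Ac.
rewrite opprD addrACA -!scalerBr (le_trans (ler_normD _ _))// !normrZ.
rewrite (@le_trans _ _ ((`|a| + `|b|) * e))//; last by rewrite ler_piMl.
by rewrite mulrDl lerD// ler_wpM2l.
Qed.

Lemma closed_thicken (E : normedModType R) (e : R) (A : set E) :
  compact A -> closed (thicken e A).
Proof.
move=> cA.
have cl : closed [set x : E | `|x| <= e].
  apply: (@closed_comp E R Num.norm [set r | r <= e]); last exact: closed_le.
  by move=> x _; exact: norm_continuous.
exact: (closed_compactD cA cl).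
Qed.

Lemma absolutely_convex_bigcap (E : lmodType R) I (A : I -> set E) :
  (forall i, absolutely_convex (A i)) -> absolutely_convex (\bigcap_i A i).
Proof.
move=> cA; split=> [i _|a b x y Ax Ay ab i _]; first exact: (proj1 (cA i)).
by apply: (proj2 (cA i)) => //; [exact: Ax|exact: Ay].
Qed.

Lemma compact_dilate (E : normedModType R) t (A : set E) :
  compact A -> compact (dilate t A).
Proof.
move=> cA; apply: continuous_compact => //; apply: continuous_subspaceT.
by move=> x; exact: scaler_continuous.
Qed.

Lemma closed_dilate (E : normedModType R) t (A : set E) :
  t != 0 -> closed A -> closed (dilate t A).
Proof.
move=> t0 clA; rewrite (_ : dilate t A = (fun x => t^-1 *: x) @^-1` A).
  by apply: closed_comp => // x _; exact: scaler_continuous.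
by apply/seteqP; split=> x /(dilateE _ _ t0).
Qed.

End absolutely_convex_sets.

(** * The Banach space normed by a gauge *)

Section gauge_space.
Context (R : realType) (E : completeNormedModType R).

(* [subsp] need not be the whole span of [disc], which may fail to be separable
   for the gauge of [disc]; it only has to be closed for that gauge. *)
Record banach_disc := BanachDisc {
  disc : set E ;
  subsp : set E ;
  disc_convex : absolutely_convex disc ;
  disc_closed : closed disc ;
  disc_bounded : exists2 M : R, 0 < M & forall x, disc x -> `|x| <= M ;
  subsp0 : subsp 0 ;
  subsp_linear : forall (a : R) x y, subsp x -> subsp y -> subsp (a *: x + y) ;
  subsp_absorbed : forall x, subsp x -> exists2 t : R, 0 <= t & dilate t disc x ;
  subsp_closed : forall x,
    (forall e : R, 0 < e -> exists2 y, subsp y & dilate e disc (x - y)) ->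
    subsp x }.

Context (D : banach_disc).
Local Notation C := (disc D).
Local Notation F := (subsp D).

Definition gauge (x : E) : R := inf [set t | 0 <= t /\ dilate t C x].

Lemma gauge_ge0 x : F x -> 0 <= gauge x.
Proof.
move=> /subsp_absorbed[t t0 Cx]; apply: lb_le_inf; first by exists t.
by move=> s [].
Qed.

(** The infimum is attained because [C] is closed: it contains [s^-1 *: x] for every [s > t], and
    [s] tends to [t]. For [t = 0], boundedness of [C] forces [x = 0]. *)
Lemma gauge_le x (t : R) : F x -> 0 <= t -> gauge x <= t <-> dilate t C x.
Proof.
move=> Fx t0; split=> [gxt|Cx]; last first.
  by apply: ge_inf => //; exists 0 => s [].
have cC := disc_convex D.
have Cxe e : 0 < e -> dilate (t + e) C x.
  move=> e0; have [||s [s0 Cx] st] := @inf_lt _ [set t | 0 <= t /\ dilate t C x] (t + e).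
  - by have [s s0 Cx] := subsp_absorbed Fx; exists s.
  - by rewrite (le_lt_trans gxt)// ltrDl.
  by apply: (dilate_le cC _ Cx); rewrite ger0_norm// ltW.
move: t0; rewrite le_eqVlt => /predU1P[t0|t0].
  suff -> : x = 0 by exact: dilate0.
  have [M M0 CM] := disc_bounded D; apply/eqP; rewrite -normr_le0.
  apply/ler_addgt0Pl => e e0; rewrite addr0.
  have [|y Cy <-] := Cxe (e / M); first by rewrite divr_gt0.
  rewrite -t0 add0r normrZ gtr0_norm ?divr_gt0//.
  by rewrite mulrAC ler_pdivrMr// ler_pM2l// CM.
apply/dilateE; first by rewrite gt_eqF.
have xcvg : s^-1 *: x @[s --> t^'+] --> t^-1 *: x.
  apply: cvg_at_right_filter; apply: cvgZr_tmp.
  by apply: cvgV; [rewrite gt_eqF|exact: cvg_id].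
suff nC : \forall s \near t^'+, C (s^-1 *: x).
  exact: (closed_cvg C (@disc_closed D) nC _ xcvg).
near=> s; have ts : t < s by near: s; exact: nbhs_right_gt.
have /Cxe : 0 < s - t by rewrite subr_gt0.
by rewrite addrC subrK => /dilateE; apply; rewrite gt_eqF// (lt_trans t0).
Unshelve. all: by end_near. Qed.

Lemma dilate_gauge x : F x -> dilate (gauge x) C x.
Proof. by move=> Fx; apply/gauge_le => //; exact: gauge_ge0. Qed.

Lemma subspZ (a : R) x : F x -> F (a *: x).
Proof.
by move=> Fx; rewrite -[a *: x]addr0; apply: subsp_linear => //; exact: subsp0.
Qed.

Lemma subspD x y : F x -> F y -> F (x + y).
Proof. by move=> Fx Fy; rewrite -[x]scale1r; exact: subsp_linear. Qed.

Lemma gaugeD x y : F x -> F y -> gauge (x + y) <= gauge x + gauge y.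
Proof.
move=> Fx Fy; apply/gauge_le; first exact: subspD.
  by rewrite addr_ge0// gauge_ge0.
by apply: (dilateD (disc_convex D));
  [exact: gauge_ge0|exact: gauge_ge0|exact: dilate_gauge|exact: dilate_gauge].
Qed.

Lemma gaugeZ_le (a : R) x : F x -> gauge (a *: x) <= `|a| * gauge x.
Proof.
move=> Fx; have g0 := gauge_ge0 Fx.
apply/gauge_le; [exact: subspZ|by rewrite mulr_ge0|].
apply: (dilate_le (disc_convex D) _ (dilateZ a (dilate_gauge Fx))).
by rewrite normrM (ger0_norm g0).
Qed.

Lemma gaugeZ (a : R) x : F x -> gauge (a *: x) = `|a| * gauge x.
Proof.
move=> Fx; apply/eqP; rewrite eq_le gaugeZ_le//=.
have [->|a0] := eqVneq a 0.
  by rewrite normr0 mul0r gauge_ge0//; exact: subspZ.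
rewrite -ler_pdivlMl ?normr_gt0// -normfV.
rewrite -{1}[x](scalerK a0); apply: gaugeZ_le; exact: subspZ.
Qed.

Lemma gauge_eq0 x : F x -> gauge x = 0 -> x = 0.
Proof. by move=> /dilate_gauge + g0; rewrite g0 => -[y _ <-]; rewrite scale0r. Qed.

Definition subsp_pred : {pred E} := fun x => `[< F x >].

Lemma subsp_predP x : reflect (F x) (x \in subsp_pred).
Proof. exact: asboolP. Qed.

Lemma subsp_submod_closed : GRing.submod_closed subsp_pred.
Proof.
split; first by apply/subsp_predP; exact: subsp0.
by move=> a x y /subsp_predP Fx /subsp_predP Fy; apply/subsp_predP; exact: subsp_linear.
Qed.

HB.instance Definition _ :=
  GRing.isSubmodClosed.Build R E subsp_pred subsp_submod_closed.

(** A type of its own, so that the gauge norm does not clash with the norm of [E]. *)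
Record gauge_space := GaugeSpace {
  gauge_val : E ; gauge_valP : gauge_val \in subsp_pred }.

HB.instance Definition _ := [isSub for gauge_val].
HB.instance Definition _ := [Choice of gauge_space by <:].
HB.instance Definition _ := [SubChoice_isSubLmodule of gauge_space by <:].

Lemma gauge_spaceP (u : gauge_space) : F (val u).
Proof. exact/subsp_predP/valP. Qed.

Lemma gauge_space_eq0 (u : gauge_space) : gauge (val u) = 0 -> u = 0.
Proof. by move=> u0; apply: val_inj; rewrite (gauge_eq0 (gauge_spaceP u)). Qed.

HB.instance Definition _ := @Lmodule_isNormed.Build R gauge_space
  (fun u => gauge (val u))
  (fun u v => gaugeD (gauge_spaceP u) (gauge_spaceP v))
  (fun a u => gaugeZ a (gauge_spaceP u))
  gauge_space_eq0.

Lemma gauge_space_norm_le (u : gauge_space) (t : R) :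
  0 <= t -> `|u| <= t <-> dilate t C (val u).
Proof. by move=> t0; apply: gauge_le => //; exact: gauge_spaceP. Qed.

(** As [C] is bounded, a Cauchy filter for the gauge is Cauchy for the norm of [E]. Its limit there
    is in [F], and is also the gauge limit, because positive multiples of [C] are closed in [E]. *)
Lemma gauge_space_complete (G : set_system gauge_space) :
  ProperFilter G -> cauchy G -> cvg G.
Proof.
move=> PG /cauchyP cG.
have [M M0 CM] := disc_bounded D.
have near_dilate (e : R) : 0 < e -> exists v : gauge_space,
    \forall u \near G, dilate e C (val v - val u).
  move=> /[dup] e0 /cG[v Gv]; exists v; apply: filterS Gv => u.
  rewrite -ball_normE /= => /ltW vu.
  rewrite (_ : val v - val u = val (v - u) :> E)//.
  by apply/gauge_space_norm_le => //; exact: ltW.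
have /cauchy_cvg valcvg : cauchy (val @ G).
  apply/cauchyP => e e0.
  have e2 : 0 < e / 2 / M by rewrite !divr_gt0.
  have [v Gv] := near_dilate _ e2.
  exists (val v); apply: filterS Gv => u [y Cy vuy] /=.
  rewrite -ball_normE /= -vuy normrZ (gtr0_norm e2).
  apply: (@le_lt_trans _ _ (e / 2)).
    by rewrite mulrAC ler_pdivrMr// ler_pM2l ?CM// divr_gt0.
  by rewrite ltr_pdivrMr// ltr_pMr// ltr1n.
set x := lim _ in valcvg.
have dist_lim (e : R) (v : gauge_space) : 0 < e ->
    (\forall u \near G, dilate e C (val v - val u)) -> dilate e C (val v - x).
  move=> e0 Gv.
  have cl : closed (dilate e C).
    by apply: closed_dilate; [rewrite gt_eqF|exact: disc_closed].
  apply: (closed_cvg _ cl Gv); apply: cvgB; [exact: cvg_cst|exact: valcvg].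
have Fx : F x.
  apply: subsp_closed => e e0; have [v Gv] := near_dilate _ e0.
  exists (val v); first exact: gauge_spaceP.
  by rewrite -opprB; apply: (dilateN (disc_convex D)); exact: dist_lim.
have xF : x \in subsp_pred by apply/subsp_predP.
apply/cvg_ex; exists (GaugeSpace xF); apply/cvg_ballP => e e0.
have e4 : 0 < e / 4 by rewrite divr_gt0.
have [v Gv] := near_dilate _ e4.
have vx := dist_lim _ _ e4 Gv.
apply: filterS Gv => u vu; rewrite -ball_normE /=.
apply: (@le_lt_trans _ _ (e / 4 + e / 4)); last by lra.
apply/gauge_space_norm_le; first by rewrite addr_ge0// ltW.
rewrite (_ : val _ = x - val u :> E)// (_ : x - val u = (val v - val u) - (val v - x)).
  by apply: (dilateB (disc_convex D)) => //; exact: ltW.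
by rewrite opprB [RHS]addrC -[RHS]addrA addKr.
Qed.

HB.instance Definition _ :=
  Uniform_isComplete.Build gauge_space gauge_space_complete.

Definition gauge_space_banach : completeNormedModType R := gauge_space.

End gauge_space.

Lemma exists_gauge_space (R : realType) (E : completeNormedModType R)
    (D : banach_disc E) :
  exists (V : completeNormedModType R) (j : {linear V -> E}),
    [/\ injective j, range j = subsp D &
      forall v t, 0 <= t -> `|v| <= t <-> dilate t (disc D) (j v)].
Proof.
exists (gauge_space_banach D), (val : {linear gauge_space D -> E}); split.
- exact: val_inj.
- apply/seteqP; split=> [_ [u _ <-]|x Fx]; first exact: gauge_spaceP.
  have xF : x \in subsp_pred D by apply/subsp_predP.
  by exists (GaugeSpace xF).
- exact: gauge_space_norm_le.
Qed.

Lemma has_finite_nets_thicken (R : realType) (E : normedModType R) (A : set E) :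
  (forall e : R, 0 < e -> exists2 K, compact K & A `<=` thicken e K) ->
  has_finite_nets A.
Proof.
move=> AK e e0; have e2 : 0 < e / 2 by rewrite divr_gt0.
have [K cK AK2] := AK _ e2.
have [s sK] := compact_has_finite_nets cK e2.
exists s => x /AK2[y /sK[z zs yz] xy]; exists z => //.
by rewrite (le_trans (ler_distD y _ _))// [leRHS]splitr lerD.
Qed.

Lemma closed_borel (T : ptopologicalType) (A : set T) :
  closed A -> measurable (A : set (borel T)).
Proof.
move=> clA; rewrite -[A]setCK; apply: measurableC.
by apply: sub_sigma_algebra; exact: closed_openC.
Qed.

(** * A separable Banach space between a compact disc and the whole space *)

Section dfjp.
Context (R : realType) (E : completeNormedModType R) (B : set E).
Hypotheses (cptB : compact B) (cvxB : absolutely_convex B).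

(* The Davis-Figiel-Johnson-Pelczynski interpolation disc between [B] and the
   unit ball. *)
Definition dfjp_disc : set E :=
  \bigcap_n thicken (2 ^- n) (dilate (2 ^+ n) B).
Local Notation C := dfjp_disc.

Lemma dfjp_disc_convex : absolutely_convex C.
Proof.
apply: absolutely_convex_bigcap => n; apply: absolutely_convex_thicken => //.
exact: absolutely_convex_dilate.
Qed.

Lemma dfjp_disc_closed : closed C.
Proof.
by apply: closed_bigI => n _; apply: closed_thicken; exact: compact_dilate.
Qed.

Lemma exists_exp2_ge (x : R) : exists n, x <= 2 ^+ n.
Proof.
have [x0|/ltW x0] := leP 0 x; last by exists 0; rewrite expr0 (le_trans x0).
exists (Num.bound x); rewrite (le_trans (ltW (archi_boundP x0)))//.
by rewrite -natrX ler_nat ltnW// ltn_expl.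
Qed.

(** For every [n], [C] lies within [2 ^- n] of the compact set [dilate (2 ^+ n) B], so it is totally
    bounded. *)
Lemma dfjp_disc_compact : compact C.
Proof.
apply: finite_nets_compact; first exact: dfjp_disc_closed.
apply: has_finite_nets_thicken => e e0.
have [n en] := exists_exp2_ge e^-1.
exists (dilate (2 ^+ n) B); first exact: compact_dilate.
move=> x /(_ n I)[y By xy]; exists y => //; rewrite (le_trans xy)//.
by rewrite invf_ple ?posrE ?exprn_gt0.
Qed.

Lemma sub_dfjp_disc : B `<=` C.
Proof.
move=> x Bx n _; exists x; last by rewrite subrr normr0 invr_ge0 exprn_ge0.
have := @dilate_le R E B cvxB 1 (2 ^+ n); rewrite dilate1; apply => //.
by rewrite normr1 exprn_ege1// ler1n.
Qed.

Lemma dilate_sub_dfjp (t : R) : 0 <= t -> dilate t B `<=` dilate t C.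
Proof. by move=> t0 x [y By <-]; exists y => //; exact: sub_dfjp_disc. Qed.

(* The gauge of [C] is continuous on the bounded multiples of [B]: this is what
   makes [B] compact for it. *)
Lemma dfjp_gauge_small (t e : R) : 0 <= t -> 0 < e ->
  exists2 d : R, 0 < d & forall x, dilate t B x -> `|x| <= d -> dilate e C x.
Proof.
move=> t0 e0; have [n tn] := exists_exp2_ge (e^-1 * t).
exists (e * 2 ^- n); first by rewrite mulr_gt0 ?invr_gt0 ?exprn_gt0.
move=> x Btx xd; apply/dilateE; first by rewrite gt_eqF.
(* For [m >= n], [e^-1 *: x] is itself in [dilate (2 ^+ m) B], as [e^-1 * t <= 2 ^+ n]; for [m < n]
   its norm is at most [2 ^- n], so 0 approximates it. *)
move=> m _; have [nm|mn] := leqP n m.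
  exists (e^-1 *: x); last by rewrite subrr normr0 invr_ge0 exprn_ge0.
  apply: (dilate_le cvxB _ (dilateZ e^-1 Btx)).
  rewrite ger0_norm ?mulr_ge0 ?invr_ge0 ?(ltW e0)// (le_trans tn)//.
  by rewrite ler_weXn2l// ler1n.
exists 0; first exact: dilate0.
rewrite subr0 normrZ gtr0_norm ?invr_gt0// ler_pdivrMl// (le_trans xd)//.
rewrite ler_pM2l// lef_pV2 ?posrE ?exprn_gt0//.
by rewrite ler_weXn2l ?ler1n// ltnW.
Qed.

(* The closure of the span of [B] for the gauge of [C]. *)
Definition dfjp_space : set E :=
  [set x | forall e : R, 0 < e ->
    exists2 t : R, 0 <= t & exists2 b, dilate t B b & dilate e C (x - b)].
Local Notation F := dfjp_space.

(** The countable form of the closure, suited to measurability and separability. *)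
Lemma dfjp_spaceP x : F x <-> forall n, exists (m : nat) b,
  dilate m%:R B b /\ dilate n.+1%:R^-1 C (x - b).
Proof.
split=> [Fx n|Fx e e0].
  have [|t t0 [b Bb Cxb]] := Fx n.+1%:R^-1; first by rewrite invr_gt0.
  exists (Num.bound t), b; split=> //; apply: (dilate_le cvxB _ Bb).
  by rewrite ger0_norm// ltW// archi_boundP.
have [n ne] := @ltr_add_invr R 0 e e0.
have [m [b [Bb Cb]]] := Fx n; exists m%:R; rewrite ?ler0n//; exists b => //.
apply: (dilate_le dfjp_disc_convex _ Cb).
by rewrite ger0_norm ?invr_ge0// (le_trans _ (ltW ne)) ?add0r.
Qed.

Lemma dilate_sub_dfjp_space (t : R) : 0 <= t -> dilate t B `<=` F.
Proof.
move=> t0 x Bx e e0; exists t => //; exists x => //.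
by rewrite subrr; apply: dilate0; exact: dfjp_disc_convex.
Qed.

(** [F] is a countable intersection of countable unions of sums of a compact multiple of [B] and a
    closed multiple of [C]; such sums are closed. *)
Lemma measurable_dfjp_space : measurable (F : set (borel E)).
Proof.
have -> : F = \bigcap_n \bigcup_m
    [set x | exists2 b, dilate (m : nat)%:R B b & dilate (n : nat).+1%:R^-1 C (x - b)].
  apply/seteqP; split=> x /=.
    move=> /dfjp_spaceP Fx n _; have [m [b [Bb Cb]]] := Fx n.
    by exists m => //; exists b.
  move=> Fx; apply/dfjp_spaceP => n; have [m _ [b Bb Cb]] := Fx n I.
  by exists m, b.
apply: bigcapT_measurable => n; apply: bigcupT_measurable => m.
apply: closed_borel; apply: closed_compactD; first exact: compact_dilate.
by apply: closed_dilate; [rewrite invr_eq0|exact: dfjp_disc_closed].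
Qed.

Lemma dfjp_disc_bounded : exists2 M : R, 0 < M & forall x, C x -> `|x| <= M.
Proof.
have /pinfty_ex_gt0[M M0 CM] := compact_bounded dfjp_disc_compact.
by exists M.
Qed.

Lemma dfjp_space0 : F 0.
Proof.
by apply: (@dilate_sub_dfjp_space 0) => //; exact: dilate0.
Qed.

Lemma dfjp_spaceD x y : F x -> F y -> F (x + y).
Proof.
move=> Fx Fy e e0; have e2 : 0 < e / 2 by rewrite divr_gt0.
have [t t0 [b Bb Cb]] := Fx _ e2; have [s s0 [c Bc Cc]] := Fy _ e2.
exists (t + s); first exact: addr_ge0.
exists (b + c); first exact: dilateD.
rewrite opprD addrACA [e in dilate e]splitr.
by apply: (dilateD dfjp_disc_convex) => //; exact: ltW.
Qed.

Lemma dfjp_spaceZ (a : R) x : F x -> F (a *: x).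
Proof.
move=> Fx e e0; have a1 : 0 < `|a| + 1 by rewrite ltr_pwDr.
have [|t t0 [b Bb Cb]] := Fx (e / (`|a| + 1)); first by rewrite divr_gt0.
exists (`|a| * t); first by rewrite mulr_ge0.
exists (a *: b).
  by apply: (dilate_le cvxB _ (dilateZ a Bb)); rewrite normrM (ger0_norm t0).
rewrite -scalerBr; apply: (dilate_le dfjp_disc_convex _ (dilateZ a Cb)).
rewrite normrM (@ger0_norm _ (_ / _)) ?divr_ge0 ?(ltW a1) ?(ltW e0)//.
by rewrite mulrCA ler_piMr ?(ltW e0)// ler_pdivrMr// mul1r lerDl.
Qed.

Lemma dfjp_space_linear (a : R) x y : F x -> F y -> F (a *: x + y).
Proof. by move=> Fx Fy; apply: dfjp_spaceD => //; exact: dfjp_spaceZ. Qed.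

Lemma dfjp_space_absorbed x : F x -> exists2 t : R, 0 <= t & dilate t C x.
Proof.
move=> /(_ 1 ltr01)[t t0 [b Bb Cb]]; exists (t + 1); first by rewrite addr_ge0.
rewrite -[x](subrK b) addrC; apply: (dilateD dfjp_disc_convex) => //.
exact: dilate_sub_dfjp.
Qed.

Lemma dfjp_space_closed x :
  (forall e : R, 0 < e -> exists2 y, F y & dilate e C (x - y)) -> F x.
Proof.
move=> Fx e e0; have e2 : 0 < e / 2 by rewrite divr_gt0.
have [y Fy Cxy] := Fx _ e2; have [t t0 [b Bb Cb]] := Fy _ e2.
exists t => //; exists b => //; rewrite -[x](subrK y) -addrA [e in dilate e]splitr.
by apply: (dilateD dfjp_disc_convex) => //; exact: ltW.
Qed.

Definition dfjp_banach_disc : banach_disc E :=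
  BanachDisc dfjp_disc_convex dfjp_disc_closed dfjp_disc_bounded dfjp_space0
    dfjp_space_linear dfjp_space_absorbed dfjp_space_closed.

Section realization.
Context (V : completeNormedModType R) (j : {linear V -> E}).
Hypothesis jF : range j = F.
Hypothesis j_norm : forall v (t : R), 0 <= t -> `|v| <= t <-> dilate t C (j v).

Lemma dfjp_embedding_continuous : continuous j.
Proof.
have [M M0 CM] := dfjp_disc_bounded.
have jM v : `|j v| <= M * `|v|.
  have /j_norm-/(_ (normr_ge0 _))[y Cy <-] := lexx `|v|.
  by rewrite normrZ normr_id mulrC ler_wpM2r// CM.
move=> v; apply/cvgrPdist_le => /= e e0; near=> w.
rewrite -linearB (le_trans (jM _))// -ler_pdivlMl// mulrC.
near: w; apply: cvgr_dist_le => //; by rewrite divr_gt0.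
Unshelve. all: by end_near. Qed.

(** Two points of [dilate t B] differ by an element of [dilate (t + t) B], where a small norm makes
    the gauge small; hence a net for the norm of [E] pulls back to one for the gauge. *)
Lemma dfjp_preimage_net (t e : R) : 0 <= t -> 0 < e ->
  exists s : seq V, forall v, dilate t B (j v) ->
    exists2 w, w \in s & `|v - w| <= e.
Proof.
move=> t0 e0; have tt0 : 0 <= t + t by rewrite addr_ge0.
have [d d0 Cd] := dfjp_gauge_small tt0 e0.
have [s sB sd] := compact_finite_net (compact_dilate (t := t) cptB) d0.
(* The default 0 never occurs: the points of [s] are in [dilate t B], hence in the range of [j]. *)
exists [seq xget 0 (j @^-1` [set y]) | y <- s] => v Bv.
have [y ys vy] := sd _ Bv.
have By : dilate t B y by exact: sB.
exists (xget 0 (j @^-1` [set y])); first exact: map_f.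
apply/j_norm; first exact: ltW.
have [w _ jw] : range j y by rewrite jF; exact: dilate_sub_dfjp_space By.
have -> : j (v - xget 0 (j @^-1` [set y])) = j v - y.
  by rewrite linearB /=; case: xgetP => [u _ <-//|/(_ w) []].
by apply: Cd => //; exact: dilateB.
Qed.

Lemma dfjp_preimage_compact (t : R) : 0 <= t -> compact (j @^-1` dilate t B).
Proof.
move=> t0; apply: finite_nets_compact.
  apply: closed_comp => [v _|]; first exact: dfjp_embedding_continuous.
  by apply: compact_closed; [exact: norm_hausdorff|exact: compact_dilate].
by move=> e e0; exact: dfjp_preimage_net.
Qed.

(** The integer multiples of [B] have a union dense in [F] for the gauge; collecting finite nets of
    each, of every mesh [n.+1%:R^-1], gives a countable dense set. *)
Lemma dfjp_separable : separable_space V.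
Proof.
have net (p : nat * nat) : {s : seq V | forall v, dilate p.1%:R B (j v) ->
    exists2 w, w \in s & `|v - w| <= p.2.+1%:R^-1}.
  by apply: cid; apply: dfjp_preimage_net; rewrite ?ler0n ?invr_gt0.
exists (\bigcup_p [set` sval (net p)]).
  apply: bigcup_countable => [|p _]; first exact: countableP.
  by apply: finite_set_countable; exact: finite_seq.
move=> O [v Ov] oO.
have /nbhs_ballP[e /= e0 eO] : nbhs v O by exact: open_nbhs_nbhs.
have e2 : 0 < e / 2 by rewrite divr_gt0.
have [n] := @ltr_add_invr R 0 _ e2; rewrite add0r => ne.
have /dfjp_spaceP/(_ n)[m [b [Bb Cb]]] : F (j v) by rewrite -jF; exists v.
have [w _ jw] : range j b.
  by rewrite jF; apply: dilate_sub_dfjp_space Bb; rewrite ler0n.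
have [u us wu] : exists2 u, u \in sval (net (m, n)) & `|w - u| <= n.+1%:R^-1.
  by apply: (svalP (net (m, n))); rewrite jw.
exists u; split; last by exists (m, n).
apply: eO; rewrite -ball_normE /=.
rewrite (le_lt_trans (ler_distD w _ _))// [ltRHS]splitr.
apply: ltrD; last exact: le_lt_trans ne.
by apply: le_lt_trans ne; apply/j_norm; rewrite ?invr_ge0// linearB /= jw.
Qed.

Lemma dfjp_bounded_precompact (A : set V) : bounded_set A -> precompact (j @` A).
Proof.
move=> /pinfty_ex_gt0[M M0 AM].
apply: (@sub_compact_precompact _ _ _ (dilate M C)).
  by apply: compact_dilate; exact: dfjp_disc_compact.
by move=> _ [v Av <-]; apply/j_norm; [exact: ltW|exact: AM].
Qed.

End realization.

End dfjp.

(** * Separation of a point from a closed absolutely convex set *)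

Section hahn_banach.
Context (R : realType) (E : lmodType R).

Definition sublinear (p : E -> R) : Prop :=
  (forall x y, p (x + y) <= p x + p y) /\
  (forall (t : R) x, 0 <= t -> p (t *: x) = t * p x).

Lemma sublinear0 p : sublinear p -> p 0 = 0.
Proof. by case=> _ pZ; rewrite -(scale0r 0) pZ// mul0r. Qed.

Lemma sublinear_opp p x : sublinear p -> - p (- x) <= p x.
Proof.
move=> /[dup] sp [pD _]; rewrite -subr_ge0 opprK -(sublinear0 sp) -(subrr x).
exact: pD.
Qed.

Lemma sublinear_of_leZ (p : E -> R) :
  (forall x y, p (x + y) <= p x + p y) -> p 0 = 0 ->
  (forall (t : R) x, 0 < t -> p (t *: x) <= t * p x) -> sublinear p.
Proof.
move=> pD p0 pZ; split=> // t x; rewrite le_eqVlt => /predU1P[<-|t0].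
  by rewrite scale0r mul0r.
apply/eqP; rewrite eq_le pZ//=.
rewrite -ler_pdivlMl// -{1}[x](scalerK (lt0r_neq0 t0)) pZ//.
by rewrite invr_gt0.
Qed.

Section shrink.
Context (q : E -> R) (y : E).
Hypothesis sq : sublinear q.

(* The largest sublinear functional below [q] taking the value [- q y] at
   [- y]. *)
Definition shrink (x : E) : R :=
  inf [set q (x + t *: y) - t * q y | t in [set t | 0 <= t]].

Lemma shrink_le (t : R) x : 0 <= t -> shrink x <= q (x + t *: y) - t * q y.
Proof.
move=> t0; apply: ge_inf; last by exists t.
(* The lower bound comes from [s * q y = q (s *: y) <= q (x + s *: y) + q (- x)]. *)
exists (- q (- x)) => _ [s s0 <-]; rewrite lerBrDr addrC lerBlDr.
rewrite -(proj2 sq) //; have := proj1 sq (x + s *: y) (- x).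
by rewrite [_ + _ - x]addrAC subrr add0r.
Qed.

Lemma le_shrink x (r : R) :
  (forall t : R, 0 <= t -> r <= q (x + t *: y) - t * q y) -> r <= shrink x.
Proof.
move=> rq; apply: lb_le_inf; last by move=> _ [t t0 <-]; exact: rq.
by exists (q (x + 0 *: y) - 0 * q y), 0; rewrite /= ?lexx.
Qed.

Lemma shrink_le_self x : shrink x <= q x.
Proof. by have := @shrink_le 0 x (lexx _); rewrite scale0r mul0r addr0 subr0. Qed.

Lemma shrinkN : shrink (- y) <= - q y.
Proof.
have := @shrink_le 1 (- y) ler01.
by rewrite scale1r mul1r addNr sublinear0// sub0r.
Qed.

Lemma sublinear_shrink : sublinear shrink.
Proof.
have [qD qZ] := sq; apply: sublinear_of_leZ.
- move=> x1 x2; rewrite -lerBlDr; apply: le_shrink => t1 t10.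
  rewrite lerBlDr -lerBlDl; apply: le_shrink => t2 t20; rewrite lerBlDl.
  rewrite (le_trans (shrink_le _ (addr_ge0 t10 t20)))// scalerDl addrACA mulrDl.
  by rewrite opprD [leRHS]addrACA lerD2r qD.
- apply/eqP; rewrite eq_le (le_trans (shrink_le_self 0)) ?(sublinear0 sq)//=.
  by apply: le_shrink => t t0; rewrite add0r qZ// subrr.
- move=> t x t0; rewrite -ler_pdivrMl//; apply: le_shrink => s s0.
  rewrite ler_pdivrMl// (le_trans (shrink_le _ (mulr_ge0 (ltW t0) s0)))//.
  by rewrite -scalerA -scalerDr qZ ?(ltW t0)// mulrBr mulrA.
Qed.

End shrink.

(* A minimal sublinear functional [q] equals [shrink q y] for every [y], which
   forces [q x + q y <= q (x + y)]. *)
Lemma minimal_sublinear_linear (q : E -> R) : sublinear q ->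
  (forall q', sublinear q' -> (forall x, q' x <= q x) -> q' = q) ->
  exists f : {linear E -> R^o}, forall x, f x = q x.
Proof.
move=> sq qmin; have [qD qZ] := sq.
have qDE x y : q (x + y) = q x + q y.
  apply/eqP; rewrite eq_le qD/= -lerBrDr.
  rewrite -{1}(qmin _ (sublinear_shrink y sq) (shrink_le_self y sq)).
  by have := @shrink_le q y sq 1 x ler01; rewrite scale1r mul1r.
have qN x : q (- x) = - q x.
  by apply/eqP; rewrite -addr_eq0 -qDE addNr sublinear0.
have qlin : linear (q : E -> R^o).
  move=> a x y; rewrite qDE; congr (_ + _).
  have [/qZ ->//|/ltW a0] := leP 0 a.
  by rewrite -[a]opprK scaleNr qN qZ ?oppr_ge0// scaleNr.
pose qL := GRing.isLinear.Build R E R^o *:%R q qlin.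
pose f : {linear E -> R^o} := HB.pack (q : E -> R^o) qL.
by exists f.
Qed.

(** Zorn's lemma for the reversed order: the pointwise infimum bounds a nonempty chain, and is
    finite because a sublinear functional below [p] is at least [- p (- x)] at [x]. *)
Lemma exists_minimal_sublinear (p : E -> R) : sublinear p ->
  exists q, [/\ sublinear q, (forall x, q x <= p x) &
    forall q', sublinear q' -> (forall x, q' x <= q x) -> q' = q].
Proof.
move=> sp; pose T := {q : E -> R | sublinear q /\ forall x, q x <= p x}.
pose below (q r : T) := `[< forall x, sval r x <= sval q x >].
have [||||q qmin] := @Zorn T below.
- by move=> q; apply/asboolP.
- move=> q r s /asboolP qr /asboolP rs; apply/asboolP => x.
  exact: le_trans (rs x) (qr x).
- move=> [q Pq] [r Pr] /asboolP/= qr /asboolP/= rq.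
  by apply: eq_exist; apply/funext => x; apply/eqP; rewrite eq_le qr rq.
- move=> A totA; have [[q0 Aq0]|A0] := pselect (A !=set0); last first.
    by exists (exist _ p (conj sp (fun=> lexx _))) => q Aq; exfalso; apply: A0; exists q.
  pose m x := inf [set sval q x | q in A].
  have m_le q x : A q -> m x <= sval q x.
    move=> Aq; apply: ge_inf; last by exists q.
    exists (- p (- x)) => _ [r Ar <-]; have [sr rp] := svalP r.
    by apply: le_trans (sublinear_opp x sr); rewrite lerN2.
  have le_m x r : (forall q, A q -> r <= sval q x) -> r <= m x.
    move=> rA; apply: lb_le_inf; first by exists (sval q0 x), q0.
    by move=> _ [q Aq <-]; exact: rA.
  have sm : sublinear m.
    apply: sublinear_of_leZ.
    + move=> x y; rewrite -lerBlDr; apply: (le_m) => q Aq.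
      rewrite lerBlDr -lerBlDl; apply: (le_m) => r Ar; rewrite lerBlDl.
      (* The chain condition enters here: subadditivity of the smaller of [q] and [r] bounds
         [m (x + y)]. *)
      have [/asboolP qr|/asboolP rq] := totA _ _ Aq Ar.
        rewrite (le_trans (m_le _ _ Ar))// (le_trans (proj1 (proj1 (svalP r)) _ _))//.
        by rewrite lerD2r.
      rewrite (le_trans (m_le _ _ Aq))// (le_trans (proj1 (proj1 (svalP q)) _ _))//.
      by rewrite lerD2l.
    + apply/eqP; rewrite eq_le (le_trans (m_le _ _ Aq0)) ?(sublinear0 (proj1 (svalP q0)))//=.
      by apply: (le_m) => q Aq; rewrite (sublinear0 (proj1 (svalP q))).
    + move=> t x t0; rewrite -ler_pdivrMl//; apply: (le_m) => q Aq.
      rewrite ler_pdivrMl// (le_trans (m_le _ _ Aq))//.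
      by rewrite (proj2 (proj1 (svalP q))) ?(ltW t0).
  have mp x : m x <= p x.
    by rewrite (le_trans (m_le _ _ Aq0))//; exact: (proj2 (svalP q0)).
  by exists (exist _ m (conj sm mp)) => q Aq; apply/asboolP => x /=; exact: m_le.
exists (sval q); have [sq qp] := svalP q; split=> // r sr rq.
have rp x : r x <= p x by exact: le_trans (rq x) (qp x).
by rewrite -(qmin (exist _ r (conj sr rp))) //; apply/asboolP.
Qed.

(** A minimal sublinear functional below [shrink p h] is linear. As [shrink p h] is at most [- p h]
    at [- h], it satisfies [p h <= f h]. *)
Theorem hahn_banach (p : E -> R) (h : E) : sublinear p ->
  exists f : {linear E -> R^o}, (forall x, f x <= p x) /\ f h = p h.
Proof.
move=> sp.
have [q [sq qp qmin]] := exists_minimal_sublinear (sublinear_shrink h sp).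
have [f fq] := minimal_sublinear_linear sq qmin.
have fp x : f x <= p x.
  by rewrite fq (le_trans (qp x))//; exact: shrink_le_self.
exists f; split=> //; apply/eqP; rewrite eq_le fp/= -lerN2 -linearN.
by rewrite fq (le_trans (qp _))//; exact: shrinkN.
Qed.

End hahn_banach.

Section separation.
Context (R : realType) (E : normedModType R) (A : set E).
Hypotheses (cvxA : absolutely_convex A) (clA : closed A).

(* Hahn-Banach applied to the infimal convolution of the gauge of [A] and of
   [`|_| / d], where [ball h d] avoids [A]. *)
Theorem separate_absolutely_convex (h : E) : ~ A h ->
  exists2 f : {linear E -> R^o}, continuous f &
    (forall x, A x -> `|f x| <= 1) /\ 1 <= f h.
Proof.
move=> Ah; have : nbhs h (~` A) by apply: open_nbhs_nbhs; split=> //; exact: closed_openC.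
move=> /nbhs_ballP[d /= d0 dA].
have far x : A x -> d <= `|h - x|.
  by move=> Ax; rewrite leNgt; apply/negP => hx; apply: (dA x) => //; rewrite -ball_normE.
pose vals x := [set r : R | exists t y, [/\ 0 <= t, dilate t A y & r = t + `|x - y| / d]].
pose p x := inf (vals x).
have vals_ge0 x r : vals x r -> 0 <= r.
  by move=> [t [y [t0 _ ->]]]; rewrite addr_ge0// divr_ge0// ltW.
have p_le x t y : 0 <= t -> dilate t A y -> p x <= t + `|x - y| / d.
  move=> t0 Ay; apply: ge_inf; last by exists t, y.
  by exists 0 => r; exact: vals_ge0.
have le_p x r : (forall t y, 0 <= t -> dilate t A y -> r <= t + `|x - y| / d) ->
    r <= p x.
  move=> rx; apply: lb_le_inf; last by move=> _ [t [y [t0 Ay ->]]]; exact: rx.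
  by exists (0 + `|x - 0| / d), 0, 0; split=> //; exact: dilate0.
have p_norm x : p x <= `|x| / d.
  by have := p_le x 0 0 (lexx _) (dilate0 cvxA 0); rewrite subr0 add0r.
have p_A x : A x -> p x <= 1.
  move=> Ax; have := p_le x 1 x ler01; rewrite dilate1 subrr normr0 mul0r addr0.
  exact.
have sp : sublinear p.
  apply: sublinear_of_leZ.
  - move=> x1 x2; rewrite -lerBlDr; apply: (le_p) => t1 y1 t10 Ay1.
    rewrite lerBlDr -lerBlDl; apply: (le_p) => t2 y2 t20 Ay2; rewrite lerBlDl.
    rewrite (le_trans (p_le _ _ _ (addr_ge0 t10 t20) (dilateD cvxA t10 t20 Ay1 Ay2)))//.
    rewrite [leRHS]addrACA lerD2l -mulrDl ler_pM2r ?invr_gt0//.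
    by rewrite opprD addrACA ler_normD.
  - apply/eqP; rewrite eq_le (le_trans (p_norm 0)) ?normr0 ?mul0r//=.
    apply: (le_p) => t y t0 _.
    by rewrite addr_ge0// divr_ge0// ltW.
  - move=> t x t0; rewrite -ler_pdivrMl//; apply: (le_p) => s y s0 Ay.
    rewrite ler_pdivrMl//.
    rewrite (le_trans (p_le _ _ _ (mulr_ge0 (ltW t0) s0) (dilateZ t Ay)))//.
    by rewrite -scalerBr normrZ (gtr0_norm t0) mulrDr mulrA.
have [f [fp fh]] := hahn_banach h sp.
have f_abs x r : p x <= r -> p (- x) <= r -> `|f x| <= r.
  move=> px pNx; rewrite ler_norml (le_trans (fp x) px) andbT.
  by rewrite lerNl -linearN (le_trans (fp _) pNx).
exists f; last first.
  split=> [x Ax|]; last first.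
    (* When [t <= 1], [y] is in [A], hence at distance at least [d] from [h], and the second term
       alone is at least 1. *)
    rewrite fh; apply: (le_p) => t y t0 Ay; have [t1|/ltW t1] := leP 1 t.
      by rewrite (le_trans t1)// lerDl divr_ge0// ltW.
    have Ay1 : A y.
      by rewrite -(dilate1 A); apply: (dilate_le cvxA _ Ay); rewrite ger0_norm.
    rewrite (@le_trans _ _ (`|h - y| / d))//; last by rewrite lerDr.
    by rewrite ler_pdivlMr// mul1r far.
  apply: f_abs; apply: p_A => //.
  by rewrite -scaleN1r; apply: absolutely_convexZ => //; rewrite normrN1.
move=> x; apply/cvgrPdist_le => /= e e0; near=> w.
rewrite -linearB (@le_trans _ _ (`|x - w| / d))//.
  apply: f_abs; first exact: p_norm.
  by rewrite -normrN; exact: p_norm.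
rewrite ler_pdivrMr//; near: w; apply: cvgr_dist_le => //.
by rewrite mulr_gt0.
Unshelve. all: by end_near. Qed.

End separation.

(** * A compact disc whose span has full measure *)

Section tight_disc.
Context (R : realType).

Lemma probability_exhaust d (T : measurableType d) (P : probability T R)
    (F : (set T)^nat) :
  (forall n, measurable (F n)) -> {homo F : n m / (n <= m)%N >-> n `<=` m} ->
  P (\bigcup_n F n) = 1%E -> forall (e : R) N0, 0 < e ->
  exists2 N, (N0 <= N)%N & (P (~` F N) <= e%:E)%E.
Proof.
move=> mF homF PF e N0 e0.
have : P (F n) @[n --> \oo] --> 1%:E.
  rewrite -PF; apply: nondecreasing_cvg_mu => //.
    exact: bigcupT_measurable.
  by move=> n m nm; apply/subsetPset; exact: homF.
move=> /fine_cvg/cvgrPdist_le/(_ e e0) /= near_e.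
near \oo => N; exists N; first by near: N; exact: nbhs_infty_ge.
rewrite probability_setC// -[P (F N)]fineK ?fin_num_measure// -EFinB lee_fin.
apply: le_trans (ler_norm _) _; near: N; exact: near_e.
Unshelve. all: by end_near. Qed.

Context (E : completeNormedModType R).

Lemma separable_dense_sequence : separable_space E ->
  exists d : nat -> E, forall x (e : R), 0 < e -> exists n, `|x - d n| <= e.
Proof.
move=> [D /countable_injP[f finj] dD].
(* The sequence inverts the injection [f]; integers that [f] does not attain on [D] give the default
   0. *)
exists (fun n => xget 0 [set x | D x /\ f x = n]) => x e e0.
have [|y [xy Dy]] := dD (ball x e) _ (ball_open x e).
  by exists x; exact: ballxx.
exists (f y); case: xgetP => [z _ [Dz /finj zy]|/(_ y)[]//].
rewrite (zy (mem_set Dz) (mem_set Dy)).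
by move: xy; rewrite -ball_normE => /ltW.
Qed.

Section zonotope.
Variable d : nat -> E.

Definition zonotope n : set E :=
  [set x | exists2 c : nat -> R, forall i, `|c i| <= 1 &
                                 x = \sum_(i < n) c i *: d i].

Lemma absolutely_convex_zonotope n : absolutely_convex (zonotope n).
Proof.
split=> [|a b _ _ [c c1 ->] [c' c'1 ->] ab].
  by exists (fun=> 0) => [i|]; rewrite ?normr0// big1// => i _; rewrite scale0r.
exists (fun i => a * c i + b * c' i) => [i|].
  rewrite (le_trans (ler_normD _ _))// !normrM (le_trans _ ab)//.
  by rewrite lerD// ler_piMr.
rewrite !scaler_sumr -big_split; apply: eq_bigr => i _ /=.
by rewrite scalerDl !scalerA.
Qed.

Lemma zonotope_le n m : (n <= m)%N -> zonotope n `<=` zonotope m.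
Proof.
move=> nm _ [c c1 ->]; exists (fun i => if (i < n)%N then c i else 0) => [i|].
  by case: ifP => // _; rewrite normr0.
rewrite (big_ord_widen m (fun i => c i *: d i) nm) big_mkcond /=.
by apply: eq_bigr => i _; case: ifP => // _; rewrite scale0r.
Qed.

Lemma mem_zonotope n i : (i < n)%N -> zonotope n (d i).
Proof.
move=> ni; exists (fun k => (k == i)%:R) => [k|].
  by case: eqP; rewrite ?normr1 ?normr0.
rewrite (bigD1 (Ordinal ni))//= eqxx scale1r big1 ?addr0// => k.
by rewrite -val_eqE /= => /negPf ->; rewrite scale0r.
Qed.

(** Each new generator adds a segment: the next zonotope is a continuous image of the product of
    [[-1, 1]] and the previous one. *)
Lemma compact_zonotope n : compact (zonotope n).
Proof.
elim: n => [|n IH].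
  rewrite (_ : zonotope 0 = [set 0]); first exact: compact_set1.
  apply/seteqP; split=> [_ [c _ ->]|_ ->] /=; first by rewrite big_ord0.
  by exists (fun=> 0) => [i|]; rewrite ?normr0// big_ord0.
have -> : zonotope n.+1 =
    (fun p : R * E => p.2 + p.1 *: d n) @` (`[-1, 1] `*` zonotope n).
  apply/seteqP; split=> [_ [c c1 ->]|_ [[a z] /= [a1 [c c1 ->]] <-]].
    exists (c n, \sum_(i < n) c i *: d i) => /=; last by rewrite big_ord_recr.
    by split=> /=; [rewrite in_itv /= -ler_norml|exists c].
  exists (fun i => if (i < n)%N then c i else a) => [i|].
    by case: ifP => // _; move: a1; rewrite in_itv /= -ler_norml.
  rewrite big_ord_recr /= ltnn; congr (_ + _).
  by apply: eq_bigr => i _; rewrite ltn_ord.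
apply: continuous_compact; last by apply: compact_setX => //; exact: segment_compact.
apply: continuous_subspaceT => p; apply: cvgD; first exact: cvg_snd.
by apply: cvgZr_tmp; exact: cvg_fst.
Qed.

End zonotope.

Lemma exists_tight_disc (mu : probability (borel E) R) (xs : seq E) :
  separable_space E ->
  exists B : set E, [/\ compact B, absolutely_convex B, [set` xs] `<=` B &
    mu (\bigcup_n dilate (n : nat)%:R B) = 1%E].
Proof.
move=> /separable_dense_sequence[d0 dense_d0].
(* The prescribed points come first, so that every zonotope of order at least [size xs] contains
   them. *)
pose d i := if (i < size xs)%N then nth 0 xs i else d0 (i - size xs)%N.
have dense_d x e : 0 < e -> exists n, `|x - d n| <= e.
  move=> /(dense_d0 x)[n xn]; exists (n + size xs)%N.
  by rewrite /d ltnNge leq_addl /= addnK.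
(* By Borel-Cantelli, almost every [x] is in [A k (N k)] for all but finitely
   many [k]; dividing [x] by a large integer takes care of the others. *)
pose A k N : set (borel E) := thicken k.+1%:R^-1 (zonotope d N).
have clA k N : closed (A k N) by apply: closed_thicken; exact: compact_zonotope.
have mA k N : measurable (A k N) by exact: closed_borel.
have cvxA k N : absolutely_convex (A k N : set E).
  by apply: absolutely_convex_thicken => //; exact: absolutely_convex_zonotope.
have pickN k : {N : nat | (size xs <= N)%N /\
    (mu (~` A k N) <= (1 / (2 ^ k.+1)%:R)%:E)%E}.
  apply: cid; have [||||N xsN AN] := @probability_exhaust _ _ mu (A k) _ _ _
      (1 / (2 ^ k.+1)%:R) (size xs).
  - exact: mA.
  - by move=> n m nm x [y Zy xy]; exists y => //; exact: zonotope_le Zy.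
  - rewrite (_ : \bigcup_n _ = setT) ?probability_setT//.
    apply/seteqP; split=> // x _.
    have [|n xn] := dense_d x k.+1%:R^-1; first by rewrite invr_gt0.
    by exists n.+1 => //; exists (d n) => //; exact: mem_zonotope.
  - by rewrite divr_gt0// ltr0n expn_gt0.
  - by exists N.
pose N k := sval (pickN k).
have NP k : (size xs <= N k)%N /\ (mu (~` A k (N k)) <= (1 / (2 ^ k.+1)%:R)%:E)%E.
  exact: svalP (pickN k).
pose B : set E := \bigcap_k A k (N k).
have clB : closed B by apply: closed_bigI => k _; exact: clA.
have cptB : compact B.
  apply: finite_nets_compact => //; apply: has_finite_nets_thicken => e e0.
  have [k] := @ltr_add_invr R 0 _ e0; rewrite add0r => ke.
  exists (zonotope d (N k)); first exact: compact_zonotope.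
  move=> x /(_ k I)[y Zy xy]; exists y => //.
  exact: le_trans xy (ltW ke).
have cvxB : absolutely_convex B by apply: absolutely_convex_bigcap => k; exact: cvxA.
exists B; split=> //.
  move=> x /= xxs k _; exists x; last by rewrite subrr normr0 invr_ge0.
  have xi : (index x xs < size xs)%N by rewrite index_mem.
  rewrite -(nth_index 0 xxs) (_ : nth _ _ _ = d (index x xs)) /d ?xi//.
  rewrite -[X in zonotope _ _ X]/(if true then _ else d0 (index x xs - size xs)%N).
  rewrite -xi; apply: mem_zonotope; apply: leq_trans xi _.
  exact: (proj1 (NP k)).
have mdil n : measurable (dilate (n : nat)%:R B : set (borel E)).
  apply: closed_borel; apply: compact_closed; first exact: norm_hausdorff.
  exact: compact_dilate.
have mU : measurable (\bigcup_n dilate (n : nat)%:R B : set (borel E)).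
  exact: bigcupT_measurable.
have lim0 : mu (lim_sup_set (fun k => ~` A k (N k))) = 0%E.
  apply: lim_sup_set_cvg0 => [k|]; first exact: measurableC.
  apply: (@le_lt_trans _ _ 1%E); last by rewrite ltry.
  apply: le_trans (@epsilon_trick0 R 1 xpredT ler01).
  by apply: lee_nneseries => // k _; exact: (proj2 (NP k)).
apply/eqP; rewrite eq_le probability_le1//= -[leLHS]sube0 -lim0.
rewrite -probability_setC; last first.
  apply: bigcap_measurable => // n _.
  by apply: bigcup_measurable => k _; exact: measurableC.
apply: le_measure; [apply/mem_set|exact/mem_set|].
  apply: measurableC; apply: bigcap_measurable => // n _.
  by apply: bigcup_measurable => k _; exact: measurableC.
move=> x; rewrite /lim_sup_set setC_bigcap => -[k0 _].
rewrite setC_bigcup => xA.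
have {}xA k : (k0 <= k)%N -> A k (N k) x by move=> /xA /=; apply: contrapT.
(* With this [n], [n%:R^-1 *: x] has norm at most [k0.+1%:R^-1], so for [k < k0] it is close enough
   to 0. *)
pose n := (Num.bound (k0.+1%:R * `|x|)).+1.
have n0 : (n%:R : R) != 0 by rewrite pnatr_eq0.
exists n => //; apply/dilateE => // k _; have [k0k|kk0] := leqP k0 k.
  apply: (absolutely_convexZ (cvxA k (N k))); last exact: xA.
  by rewrite normfV ger0_norm// invf_le1// ler1n.
exists 0; first exact: (proj1 (absolutely_convex_zonotope d _)).
rewrite subr0 normrZ normfV ger0_norm//.
rewrite (@le_trans _ _ k0.+1%:R^-1)//; last first.
  by rewrite lef_pV2 ?posrE// ler_nat ltnW.
rewrite ler_pdivrMl ?ltr0n// -ler_pdivrMr ?invr_gt0// invrK mulrC.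
rewrite (le_trans (ltW (archi_boundP _))) ?mulr_ge0//.
by rewrite ler_nat.
Qed.

End tight_disc.

(** * Gaussian estimates *)

Section normal_second_moment.
Import HBNNSimple.
Context (R : realType).

(* To be applied to [fun x => `|f x - s x|] with [s] simple and [f] merely Bochner
   integrable, whose measurability [ge0_le_integral] would ask for. *)
Lemma ge0_le_integralT d (T : measurableType d) (mu : {measure set T -> \bar R})
    (f g : T -> \bar R) : (forall x, 0 <= f x)%E -> (forall x, f x <= g x)%E ->
  (\int[mu]_x f x <= \int[mu]_x g x)%E.
Proof.
move=> f0 fg; have g0 x : (0 <= g x)%E by exact: le_trans (f0 x) (fg x).
rewrite !ge0_integralTE//; apply: le_ereal_sup => _ [h hf <-].
by exists h => // x; exact: le_trans (hf x) (fg x).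
Qed.

(** The integral against [nu] of a simple function below [f] is computed fibre by fibre against
    [lam]; the inequality follows by taking the supremum. *)
Lemma le_integral_density d (T : measurableType d)
    (nu lam : {measure set T -> \bar R}) (w : T -> R) (f : T -> \bar R) :
  measurable_fun setT w -> (forall x, 0 <= w x) ->
  (forall A, measurable A -> nu A = \int[lam]_(x in A) (w x)%:E)%E ->
  (forall x, 0 <= f x)%E ->
  (\int[nu]_x f x <= \int[lam]_x (f x * (w x)%:E))%E.
Proof.
move=> mw w0 nuE f0; rewrite (ge0_integralTE nu)//.
apply: ge_ereal_sup => _ [h hf <-].
have mwE : measurable_fun setT (EFin \o w) by exact/measurable_EFinP.
have mh r : measurable (h @^-1` [set r]) by exact: measurable_sfunP.
have r0 r : r \in range h -> 0 <= r by move=> /set_mem[x _ <-].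
(* The absolute value makes [F r] nonnegative for every real [r]; it changes nothing on the values
   of [h]. *)
pose F r x := (`|r|%R%:E * ((EFin \o w) \_ (h @^-1` [set r])) x)%E.
have wr0 r x : (0 <= ((EFin \o w) \_ (h @^-1` [set r])) x)%E.
  by apply: erestrict_ge0 => y _ /=; rewrite lee_fin.
have mwr r : measurable_fun setT ((EFin \o w) \_ (h @^-1` [set r])).
  by apply/(measurable_restrictT _ _).1 => //; exact: measurable_funTS.
have -> : sintegral nu h = (\int[lam]_x \sum_(r <- fset_set (range h)) F r x)%E.
  rewrite ge0_integral_sum//; first last.
  - by move=> r x _; rewrite mule_ge0 ?lee_fin.
  - by move=> r; apply: emeasurable_funM => //; exact: measurable_cst.
  rewrite sintegralE fsbig_finite//; apply: eq_big_seq => r.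
  rewrite in_fset_set// => /r0 rge0; rewrite /F ger0_norm//.
  rewrite ge0_integralZl ?lee_fin//.
  by rewrite nuE// integral_mkcond.
apply: ge0_le_integralT => x.
  by apply: sume_ge0 => r _; rewrite mule_ge0 ?lee_fin.
rewrite (bigD1_seq (h x)) ?fset_uniq//=; last first.
  by rewrite in_fset_set//; apply/mem_set; exists x.
rewrite big1_seq ?adde0 => [|r /andP[rx _]].
  have -> : F (h x) x = ((h x)%:E * (w x)%:E)%E.
    by rewrite /F patchE mem_set// ger0_norm.
  by rewrite lee_wpmul2r ?lee_fin//; exact: hf.
rewrite /F patchE ifF ?mule0//; apply/negbTE; rewrite notin_setE /= => rhx.
by rewrite rhx eqxx in rx.
Qed.

(** This bounds the second moment by a multiple of the total mass of a wider normal law. With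
    [u = x ^+ 2 / (4 * s ^+ 2)] it reduces to [u <= expR (u * (3 / 2))], a consequence of
    [1 + y <= expR y]. *)
Lemma sqr_normal_pdf_le (s x : R) : 0 < s ->
  x ^+ 2 * normal_pdf 0 s x <= 8 * s ^+ 2 * normal_pdf 0 (2 * s) x.
Proof.
move=> s0; have s20 : 0 < 2 * s by rewrite mulr_gt0.
rewrite !normal_pdfE ?gt_eqF// /normal_peak /normal_fun.
have -> : (2 * s) ^+ 2 * pi *+ 2 = 2 ^+ 2 * (s ^+ 2 * pi *+ 2) :> R.
  by rewrite exprMn -mulrA mulrnAr.
rewrite sqrtrM ?exprn_ge0// sqrtr_sqr ger0_norm// !subr0.
set P := Num.sqrt _; have P0 : 0 < P^-1.
  by rewrite invr_gt0 sqrtr_gt0 pmulrn_lgt0// mulr_gt0 ?pi_gt0// exprn_gt0.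
set u := x ^+ 2 / (4 * s ^+ 2).
have u0 : 0 <= u by rewrite divr_ge0 ?sqr_ge0// mulr_ge0 ?sqr_ge0.
have xu : x ^+ 2 = 4 * s ^+ 2 * u.
  by rewrite /u mulrC divfK// mulf_neq0// expf_neq0// gt_eqF.
clearbody u; rewrite xu.
have -> : - (4 * s ^+ 2 * u) / (s ^+ 2 *+ 2) = - (2 * u).
  by field; rewrite gt_eqF.
have -> : - (4 * s ^+ 2 * u) / ((2 * s) ^+ 2 *+ 2) = - (u / 2).
  by field; rewrite gt_eqF.
have uexp : u * expR (- (2 * u)) <= expR (- (u / 2)).
  have -> : - (u / 2) = u * (3 / 2) + - (2 * u) by field.
  rewrite expRD ler_pM2r ?expR_gt0//.
  apply: le_trans (expR_ge1Dx _); lra.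
have Pn0 : P != 0 by rewrite -invr_eq0 gt_eqF.
set a := expR _ in uexp *; set b := expR _ in uexp *.
have -> : 4 * s ^+ 2 * u * (P^-1 * a) = 4 * s ^+ 2 * P^-1 * (u * a) by field.
have -> : 8 * s ^+ 2 * ((2 * P)^-1 * b) = 4 * s ^+ 2 * P^-1 * b by field.
by rewrite ler_wpM2l// mulr_ge0 ?(ltW P0)// mulr_ge0// sqr_ge0.
Qed.

Lemma normal_second_moment (s : R) : 0 < s ->
  (\int[normal_prob 0 s]_x (x ^+ 2)%:E <= (8 * s ^+ 2)%:E)%E.
Proof.
move=> s0.
apply: le_trans (@le_integral_density _ _ _ lebesgue_measure _ _
  (measurable_normal_pdf 0 s) (normal_pdf_ge0 0 s) _ _) _.
- by [].
- by move=> x; rewrite lee_fin sqr_ge0.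
apply: (@le_trans _ _ (\int[lebesgue_measure]_x
    ((8 * s ^+ 2)%:E * (normal_pdf 0 (2 * s) x)%:E))%E).
  apply: ge0_le_integralT => x; rewrite -EFinM lee_fin.
    by rewrite mulr_ge0 ?sqr_ge0 ?normal_pdf_ge0.
  exact: sqr_normal_pdf_le.
rewrite ge0_integralZl_EFin//.
- by rewrite integral_normal_pdf mule1.
- by move=> x _; rewrite lee_fin normal_pdf_ge0.
- by apply/measurable_EFinP; exact: measurable_normal_pdf.
- by rewrite mulr_ge0// exprn_ge0// ltW.
Qed.

(** The density is at most [s^-1], so the interval has mass at most [2 / s], and [3 / 4 <= 2 / s]
    gives [s <= 8 / 3]. *)
Lemma normal_prob_concentrated (s : R) : 0 < s ->
  ((3 / 4)%:E <= normal_prob 0 s `[(-1)%R, 1%R])%E -> s <= 3.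
Proof.
move=> s0 s34.
have peak_le : normal_peak s <= s^-1.
  rewrite /normal_peak lef_pV2 ?posrE//; last first.
    by rewrite sqrtr_gt0 pmulrn_lgt0// mulr_gt0 ?pi_gt0// exprn_gt0.
  rewrite -[X in X <= _](gtr0_norm s0) -sqrtr_sqr; apply: ler_wsqrtr.
  rewrite -mulrnAr ler_peMr ?sqr_ge0//.
  by have := pi_ge2 R; lra.
have : (normal_prob 0 s `[(-1)%R, 1%R] <= (2 * s^-1)%:E)%E.
  rewrite /normal_prob.
  apply: (@le_trans _ _ (\int[lebesgue_measure]_(x in `[(-1)%R, 1%R]) (cst (s^-1)%:E x))%E).
    apply: ge0_le_integral => //=.
    - by move=> x _; rewrite lee_fin normal_pdf_ge0.
    - by apply/measurable_funTS/measurable_EFinP; exact: measurable_normal_pdf.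
    - by move=> x _; rewrite lee_fin (le_trans _ peak_le)// normal_pdf_ub// gt_eqF.
  rewrite integral_cst//= lebesgue_measure_itv /= lte_fin.
  rewrite ifT; last by lra.
  by rewrite -EFinB -EFinM lee_fin mulrC opprK.
move=> /(le_trans s34); rewrite lee_fin ler_pdivlMr//; lra.
Qed.

End normal_second_moment.

Section gaussian_functionals.
Context (R : realType) (E : completeNormedModType R).
Variable mu : probability (borel E) R.

Lemma measurable_functional (xi : {linear E -> R^o}) : continuous xi ->
  measurable_fun [set: borel E] (xi : borel E -> R).
Proof.
move=> /continuousP cxi; apply: (measurability _ (RGenOpens.measurableE R)).
move=> _ [_ [a [b ->] <-]]; rewrite setTI.
by apply: sub_sigma_algebra; apply: cxi; exact: interval_open.
Qed.

(* The standard deviation of [xi] is at most 3, so the second moment is at most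
   [8 * 3 ^+ 2]. *)
Lemma gaussian_second_moment (xi : {linear E -> R^o}) :
  centered_gaussian mu -> continuous xi ->
  ((3 / 4)%:E <= mu (xi @^-1` `[(-1)%R, 1%R]))%E ->
  (\int[mu]_x ((xi x : R) ^+ 2)%:E <= 81%:E)%E.
Proof.
move=> muG cxi xi34; have [s s0 muxi] := muG xi cxi.
have mxi : measurable_fun setT (xi : borel E -> measurableTypeR R).
  exact: measurable_functional.
have mX2 : measurable_fun setT (fun y : measurableTypeR R => (y ^+ 2)%:E).
  by apply/measurable_EFinP; exact: measurable_funX.
pose X : {mfun borel E >-> measurableTypeR R} :=
  HB.pack (xi : borel E -> measurableTypeR R) (isMeasurableFun.Build _ _ _ _ _ mxi).
rewrite -[leLHS](@ge0_integral_distribution _ _ _ _ _ mu X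
  (fun y : measurableTypeR R => (y ^+ 2)%:E))//; last first.
  by move=> y; rewrite lee_fin sqr_ge0.
move: s0 muxi; rewrite le_eqVlt => /predU1P[<-|s0] muxi.
  rewrite (eq_measure_integral (\d_(0 : measurableTypeR R))) => [|A mA _].
    by rewrite integral_dirac//= expr0n mule0 lee_fin.
  by have := muxi A mA; rewrite /centered_normal eqxx.
have s1 : s != 0 by rewrite gt_eqF.
rewrite (eq_measure_integral (normal_prob 0 s)) => [|A mA _]; last first.
  by have := muxi A mA; rewrite /centered_normal (negbTE s1).
apply: le_trans (normal_second_moment s0) _; rewrite lee_fin.
have s3 : s <= 3.
  apply: normal_prob_concentrated => //.
  have := muxi `[(-1)%R, 1%R]%classic (measurable_itv _).
  by rewrite /centered_normal (negbTE s1) => <-.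
have : s ^+ 2 <= 3 ^+ 2 by rewrite lerXn2r// nnegrE ltW.
lra.
Qed.

End gaussian_functionals.

(** * Continuous functionals of Bochner integrals *)

Section bochner_functional.
Context d (T : measurableType d) (R : realType) (V : completeNormedModType R).
Variable mu : probability T R.

Lemma simple_functional (s : T -> V) (xi : {linear V -> R^o}) :
  simple_function s ->
  mu.-integrable setT (fun x => (xi (s x) : R)%:E) /\
  (\int[mu]_x (xi (s x) : R)%:E = (xi (simple_integral mu s) : R)%:E)%E.
Proof.
move=> [fins ms].
have ->: (fun x => (xi (s x) : R)%:E) =
    (fun x => \sum_(v <- fset_set (range s))
      ((xi v : R)%:E * (\1_(s @^-1` [set v]) x)%:E)%E).
  apply/funext => x.
  rewrite (bigD1_seq (s x)) ?fset_uniq//=; last first.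
    by rewrite in_fset_set//; apply/mem_set; exists x.
  rewrite big1_seq ?adde0 => [|v /andP[vx _]].
    by rewrite indicE mem_set// mule1.
  rewrite indicE memNset ?mule0//= => svx.
  by rewrite svx eqxx in vx.
have int1 v : mu.-integrable setT
    (fun x => ((xi v : R)%:E * (\1_(s @^-1` [set v]) x)%:E)%E).
  by apply: integrableZl => //; exact: integrable_indic.
split; first exact: integrable_sum.
rewrite integral_sum// /simple_integral fsbig_finite//= linear_sum -sumEFin.
apply: eq_bigr => v _; rewrite integralZl//; last exact: integrable_indic.
rewrite integral_indic// setIT linearZ /= /GRing.scale /= mulrC EFinM fineK//.
exact: fin_num_measure.
Qed.

(** Linearity gives the case of simple functions; the limit is controlled by the boundedness of
    [xi], as the distance from [xi (f x)] to [xi (s n x)] is at most [M] times that from [f x] to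
    [s n x]. *)
Lemma bochner_functional (f : T -> V) (y : V) (xi : {linear V -> R^o}) :
  continuous xi -> is_bochner_integral mu f y ->
  mu.-integrable setT (fun x => (xi (f x) : R)%:E) ->
  (xi y : R) = \int[mu]_x (xi (f x) : R).
Proof.
move=> cxi [s [ss _ fs sy]] intf.
have [M M0 xiM] : exists2 M : R, 0 < M & forall v, `|xi v| <= M * `|v|.
  have /linear_boundedP/pinfty_ex_gt0[M M0 xiM] :=
    continuous_linear_bounded 0 (cxi 0).
  by exists M.
have xis : (xi (simple_integral mu (s n)) : R) @[n --> \oo] --> (xi y : R).
  exact: (continuous_cvg _ (cxi y) sy).
suff xif : (xi (simple_integral mu (s n)) : R) @[n --> \oo] --> \int[mu]_x (xi (f x) : R).
  by rewrite -(cvg_lim (@Rhausdorff R) xis) (cvg_lim (@Rhausdorff R) xif).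
apply/cvgrPdist_le => e e0.
have eM : 0 < e / M by rewrite divr_gt0.
have /fine_cvgP[fin_fs /cvgrPdist_le/(_ _ eM) near_fs] := fs.
near=> n.
have [ints xisE] := simple_functional xi (ss n).
have -> : xi (simple_integral mu (s n)) = \int[mu]_x (xi (s n x) : R).
  by rewrite /Rintegral xisE.
rewrite -RintegralB//.
have intB : mu.-integrable setT (EFin \o (fun x => (xi (f x) - xi (s n x) : R))).
  exact: (integrableB _ intf ints).
apply: le_trans (le_normr_Rintegral _ intB) _ => //.
(* The constant stays on the side of [xi], where the integrand is known to be measurable and the
   constant can be taken out of the integral. *)
have le1 : (\int[mu]_x (M^-1 * `|xi (f x) - xi (s n x) : R|)%:E <=
    \int[mu]_x (`|f x - s n x|)%:E)%E.
  apply: ge0_le_integralT => x; rewrite lee_fin.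
    by rewrite mulr_ge0// invr_ge0 ltW.
  by rewrite ler_pdivrMl// -linearB.
have fin_n : (\int[mu]_x (`|f x - s n x|)%:E)%E \is a fin_num by near: n.
have le2 : fine (\int[mu]_x (`|f x - s n x|)%:E)%E <= e / M.
  have : `|0 - fine (\int[mu]_x (`|f x - s n x|)%:E)%E| <= e / M by near: n.
  by rewrite sub0r normrN; apply: le_trans; exact: ler_norm.
have le3 : (\int[mu]_x (`|xi (f x) - xi (s n x) : R|)%:E <= e%:E)%E.
  rewrite -(@lee_pmul2l _ (M^-1)%:E) ?lte_fin ?invr_gt0//.
  rewrite -ge0_integralZl_EFin ?invr_ge0 ?(ltW M0)//; last first.
    apply/measurable_EFinP; apply: measurableT_comp => //.
    by apply/measurable_EFinP; exact: measurable_int intB.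
  by rewrite (le_trans le1)// -[leLHS]fineK// -EFinM lee_fin mulrC.
rewrite -lee_fin /Rintegral fineK//.
by rewrite ge0_fin_numE ?integral_ge0// (le_lt_trans le3)// ltry.
Unshelve. all: by end_near. Qed.

End bochner_functional.

(** * Absorption of the RKHS by closed absolutely convex sets of large measure *)

Section rkhs_absorbed.
Context (R : realType) (E : completeNormedModType R).
Variable mu : probability (borel E) R.

(** [xi h] is the integral of [g * xi], where [g] is the representative of [h] selected in
    [rkhs_dot]; the arithmetic-geometric inequality bounds it by half the sum of the two second
    moments. *)
Lemma rkhs_functional_le (h : E) (xi : {linear E -> R^o}) : continuous xi ->
  rkhs mu h -> (\int[mu]_x ((xi x : R) ^+ 2)%:E <= 81%:E)%E ->
  (xi h : R) <= (rkhs_norm mu h ^+ 2 + 81) / 2.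
Proof.
move=> cxi [g0 hg0] xi81; have mxi := measurable_functional cxi.
rewrite /rkhs_norm /rkhs_dot; set g := xget _ _.
have [[gL2 _] hg] : rkhs_repr mu h g by rewrite /g; case: xgetP => // /(_ g0).
have mg : measurable_fun setT g.
  by have /set_mem := sub_Lfun_mfun gL2.
have ig2 : mu.-integrable setT (EFin \o (fun x => g x * g x)).
  by have := Lfun2_integrable_sqr gL2; under eq_fun do rewrite expr2.
have ixi2 : mu.-integrable setT (EFin \o (fun x => (xi x : R) * xi x)).
  apply/integrableP; split.
    by apply/measurable_EFinP; exact: measurable_funM.
  apply: (@le_lt_trans _ _ 81%:E); last by rewrite ltry.
  apply: le_trans xi81; rewrite le_eqVlt; apply/orP; left; apply/eqP.
  by apply: eq_integral => x _; rewrite /= -expr2 ger0_norm ?sqr_ge0.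
have isum : mu.-integrable setT (EFin \o (fun x => (g x * g x + (xi x : R) * xi x))).
  exact: (integrableD _ ig2 ixi2).
have ihalf : mu.-integrable setT
    (EFin \o (fun x => 2^-1 * (g x * g x + (xi x : R) * xi x))).
  exact: (integrableZl _ _ isum).
have amgm (a b : R) : `|a * b| <= 2^-1 * (a * a + b * b).
  rewrite ler_norml; apply/andP; split.
    by have := sqr_ge0 (a + b); lra.
  by have := sqr_ge0 (a - b); lra.
have igxi : mu.-integrable setT (EFin \o (fun x => g x * (xi x : R))).
  apply: le_integrable ihalf => //.
    by apply/measurable_EFinP; exact: measurable_funM.
  move=> x _ /=; rewrite lee_fin (le_trans (amgm _ _))//.
  exact: ler_norm.
have igxi' : mu.-integrable setT (fun x : borel E => (xi (g x *: (x : E)) : R)%:E).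
  by under eq_fun do rewrite linearZ.
rewrite (bochner_functional cxi hg igxi').
under eq_Rintegral do rewrite linearZ.
rewrite sqr_sqrtr; last by apply: Rintegral_ge0 => x _; rewrite -expr2 sqr_ge0.
apply: (@le_trans _ _ (\int[mu]_x (2^-1 * (g x * g x + (xi x : R) * xi x)))).
  apply: le_Rintegral => // x _.
  exact: le_trans (ler_norm _) (amgm _ _).
rewrite RintegralZl// RintegralD// mulrC ler_pM2r ?invr_gt0// lerD2l.
rewrite /Rintegral -lee_fin fineK; last exact: integrable_fin_num.
by under eq_integral do rewrite -expr2.
Qed.

(* If [h] is not in [dilate t A], some [eta] bounded by 1 on [A] has
   [t <= eta h], against [rkhs_functional_le]. *)
Lemma rkhs_absorbed (A : set E) (h : E) : centered_gaussian mu ->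
  closed A -> absolutely_convex A -> ((3 / 4)%:E <= mu A)%E -> rkhs mu h ->
  dilate ((rkhs_norm mu h ^+ 2 + 81) / 2 + 1) A h.
Proof.
move=> muG clA cvxA A34 Hh; set t := _ + 1.
have t0 : 0 < t by rewrite ltr_pwDr// divr_ge0// addr_ge0// sqr_ge0.
have [//|Nth] := pselect (dilate t A h).
have [xi cxi [xiA xih]] := separate_absolutely_convex
    (absolutely_convex_dilate cvxA t) (closed_dilate (lt0r_neq0 t0) clA) Nth.
have [eta etaE] : exists eta : {linear E -> R^o}, forall x, eta x = t *: xi x.
  by exists (t \*: xi).
have ceta : continuous eta.
  move=> x; rewrite (_ : (eta : E -> R^o) = (fun x => t *: xi x)); last exact/funext.
  by apply: cvgZl_tmp; exact: cxi.
have eta34 : ((3 / 4)%:E <= mu (eta @^-1` `[(-1)%R, 1%R]))%E.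
  apply: le_trans A34 _; apply: le_measure.
  - by apply/mem_set; exact: closed_borel.
  - apply/mem_set; rewrite -[X in measurable X]setTI.
    by apply: (measurable_functional ceta) => //; exact: measurable_itv.
  move=> x Ax /=; rewrite in_itv /= -ler_norml etaE -linearZ.
  by apply: xiA; exists x.
have := rkhs_functional_le ceta Hh (gaussian_second_moment muG ceta eta34).
rewrite etaE /GRing.scale /= => th.
(* [t - 1] is the upper bound just obtained for [eta h = t * xi h], whereas [1 <= xi h]. *)
suff : t <= t - 1 by lra.
rewrite /t addrK -/t; apply: le_trans th.
by rewrite ler_peMr// ltW.
Qed.

End rkhs_absorbed.

(** * Intermediate spaces *)

Section finite_dimension.
Context (R : realType) (E : completeNormedModType R).

(* Iterating the approximation of the unit ball by a finite [2^-1]-net [v]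
   expands [x] as [\sum_k 2^-k *: v (i_ k)]; gathering equal indices gives the
   coefficients of [x] on [v]. *)
Lemma unit_ball_span n (v : 'I_n -> E) :
  (forall x : E, `|x| <= 1 -> exists i, `|x - v i| <= 2^-1) ->
  forall x : E, `|x| <= 1 -> exists c : 'I_n -> R, x = \sum_(i < n) c i *: v i.
Proof.
move=> net x x1.
have /choice[f fP] : forall y : E, exists i, `|y| <= 1 -> `|y - v i| <= 2^-1.
  move=> y; have [/net[i yi]|y1] := leP `|y| 1; first by exists i.
  by have [|i _] := net 0; [rewrite normr0|exists i].
(* [y k] is the remainder after [k] approximations, magnified by [2 ^+ k], which keeps it in the
   unit ball. *)
pose y k := iter k (fun z => 2 *: (z - v (f z))) x.
have y1 k : `|y k| <= 1.
  elim: k => [//|k /fP yk]; rewrite /= normrZ ger0_norm//.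
  by rewrite -ler_pdivlMl// mulr1.
pose c m i : R := \sum_(k < m | f (y k) == i) 2 ^- k.
have xE m : x = \sum_(i < n) c m i *: v i + 2 ^- m *: y m.
  elim: m => [|m IH].
    rewrite big1 ?add0r ?expr0 ?invr1 ?scale1r// => i _.
    by rewrite /c big_ord0 scale0r.
  rewrite [LHS]IH /= scalerA exprS invfM mulrAC mulVf// mul1r scalerBr.
  have -> : \sum_(i < n) c m.+1 i *: v i =
      \sum_(i < n) c m i *: v i + 2 ^- m *: v (f (y m)).
    rewrite (bigD1 (f (y m)))//= [in RHS](bigD1 (f (y m)))//= addrAC -scalerDl.
    congr (_ *: _ + _); first by rewrite /c big_mkcond big_ord_recr /= eqxx -big_mkcond.
    apply: eq_bigr => i /negPf ifym; congr (_ *: _).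
    by rewrite /c big_mkcond big_ord_recr /= eq_sym ifym addr0 -big_mkcond.
  by rewrite -[RHS]addrA; congr (_ + _); rewrite addrC subrK.
have c_nd i : nondecreasing_seq (c ^~ i).
  apply/nondecreasing_seqP => m; rewrite /c [leRHS]big_mkcond big_ord_recr /=.
  by rewrite -big_mkcond lerDl; case: ifP => // _; rewrite invr_ge0 exprn_ge0.
have c_le2 m i : c m i <= 2.
  apply: (@le_trans _ _ (\sum_(k < m) 2 ^- k)).
    rewrite /c big_mkcond; apply: ler_sum => k _.
    by case: ifP => // _; rewrite invr_ge0 exprn_ge0.
  suff -> : \sum_(k < m) 2 ^- k = 2 - 2 * 2 ^- m :> R.
    by rewrite lerBlDr lerDl mulr_ge0// invr_ge0 exprn_ge0.
  elim: m => [|m IH]; first by rewrite big_ord0 expr0 invr1 mulr1 subrr.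
  by rewrite big_ord_recr /= IH exprS invfM; field; rewrite expf_neq0.
have c_cvg i : cvg (c m i @[m --> \oo]).
  by apply: nondecreasing_is_cvgn => //; exists 2 => _ [m _ <-].
exists (fun i => limn (c ^~ i)).
have lim1 : \sum_(i < n) c m i *: v i @[m --> \oo] -->
    \sum_(i < n) limn (c ^~ i) *: v i.
  apply: cvg_big => [|i _]; [exact: add_continuous|apply: cvgZr_tmp; exact: c_cvg].
have lim2 : \sum_(i < n) c m i *: v i @[m --> \oo] --> x.
  apply/cvgrPdist_le => e e0; have [N eN] := exists_exp2_ge e^-1.
  near=> m; rewrite {1}(xE m) addrAC subrr add0r normrZ ger0_norm ?invr_ge0 ?exprn_ge0//.
  rewrite (@le_trans _ _ (2 ^- m))//; first by rewrite ler_piMr ?invr_ge0 ?exprn_ge0.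
  rewrite invf_ple ?posrE ?exprn_gt0// (le_trans eN)// ler_weXn2l ?ler1n//.
  by near: m; exact: nbhs_infty_ge.
by rewrite -(cvg_lim (@norm_hausdorff _ _) lim1) (cvg_lim (@norm_hausdorff _ _) lim2).
Unshelve. all: by end_near. Qed.

(** An [r / 4]-net of [K], translated by [- x0] and divided by [r / 2], is a [2^-1]-net of the unit
    ball, so [unit_ball_span] applies. *)
Lemma compact_ball_finite_dimensional (K : set E) (x0 : E) (r : R) :
  compact K -> 0 < r -> ball x0 r `<=` K -> ~ infinite_dimensional E.
Proof.
move=> cK r0 ballK Einf.
have r4 : 0 < r / 4 by rewrite divr_gt0.
have [s sK] := compact_has_finite_nets cK r4.
pose v (i : 'I_(size s)) := (r / 2)^-1 *: (s`_i - x0).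
(* Zero coefficients settle the case [x = 0]; any other [x] is normalised first, and the goal is
   then abandoned for another choice of coefficients. *)
have [x xv] := Einf _ v; apply: (xv (fun=> 0)).
have net z : `|z| <= 1 -> exists i, `|z - v i| <= 2^-1.
  move=> z1; have [|y ys zy] := sK (x0 + (r / 2) *: z).
    apply: ballK; rewrite -ball_normE /= opprD addNKr normrN normrZ.
    rewrite gtr0_norm ?divr_gt0// (@le_lt_trans _ _ (r / 2))//.
      by rewrite ler_piMr// divr_ge0// ltW.
    by rewrite ltr_pdivrMr// ltr_pMr// ltr1n.
  have yi : (index y s < size s)%N by rewrite index_mem.
  exists (Ordinal yi); rewrite /v /= nth_index//.
  have r2 : 0 < r / 2 by rewrite divr_gt0.
  rewrite -[z](scalerK (lt0r_neq0 r2)) -scalerBr normrZ gtr0_norm ?invr_gt0//.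
  rewrite ler_pdivrMl// opprB addrA [_ + x0]addrC (le_trans zy)//.
  by lra.
have [x00|xn0] := eqVneq x 0.
  by rewrite x00 big1// => i _; rewrite scale0r.
have nx : 0 < `|x| by rewrite normr_gt0.
have [|c xc] := unit_ball_span net (x := `|x|^-1 *: x).
  by rewrite normrZ normfV normr_id mulVf ?gt_eqF.
exfalso; apply: (xv (fun i => `|x| * c i)).
rewrite -[LHS](scalerKV (lt0r_neq0 nx)) xc scaler_sumr.
by apply: eq_bigr => i _; rewrite scalerA.
Qed.

(** If [j] were onto, the compact sets [K n] would cover [E], and by Baire one of them would contain
    a ball. *)
Lemma compact_embedding_proper (V : completeNormedModType R) (j : {linear V -> E}) :
  infinite_dimensional E ->
  (forall A : set V, bounded_set A -> precompact (j @` A)) -> range j <> setT.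
Proof.
move=> Einf jcpt jT.
pose K (n : nat) := closure (j @` [set v | `|v| <= n%:R]).
have cptK n : compact (K n).
  rewrite /K -precompactE; apply: jcpt.
  by exists n%:R; split; [exact: num_real|move=> M nM v /= /le_trans; apply; exact: ltW].
have [allD|/existsNP[n Nd]] := pselect (forall n, dense (~` K n)).
  have /Baire/(_ setT)[||x [_ Kx]] : forall n, open (~` K n) /\ dense (~` K n).
    by move=> n; split=> //; apply: closed_openC; exact: closed_closure.
  - by exists 0.
  - exact: openT.
  have [v _ jv] : range j x by rewrite jT.
  apply: (Kx (Num.bound `|v|) I); apply: subset_closure; exists v => //=.
  by rewrite ltW// archi_boundP.
move: Nd; rewrite /dense => /existsNP[U] /not_implyP[[x Ux]] /not_implyP[oU UN].
have /nbhs_ballP[r /= r0 rU] : nbhs x U by exact: open_nbhs_nbhs.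
apply: (compact_ball_finite_dimensional (cptK n) r0 _ Einf) => z /rU Uz.
by apply: contrapT => Kz; apply: UN; exists z.
Qed.

End finite_dimension.

Lemma intermediate_space_neq_setT (R : realType) (E : completeNormedModType R)
    (mu : probability (borel E) R) (F : set E) :
  infinite_dimensional E -> intermediate_space mu F -> F <> setT.
Proof.
move=> Einf [V [j [[_ <- _] [_ _ _ _ jcpt]]]].
exact: compact_embedding_proper.
Qed.

(** Some [dilate n%:R B] has measure at least 3/4, so it absorbs each RKHS vector with a factor
    controlled by its norm; a bounded set of the RKHS thus lies in a single multiple of [B], whose
    preimage in [V] is compact. *)
Lemma exists_intermediate_space (R : realType) (E : completeNormedModType R)
    (mu : probability (borel E) R) (xs : seq E) :
  separable_space E -> centered_gaussian mu ->
  exists2 F, intermediate_space mu F & [set` xs] `<=` F.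
Proof.
move=> Esep muG.
have [B [cptB cvxB xsB muB]] := exists_tight_disc mu xs Esep.
have [V [j [j_inj jF j_norm]]] := exists_gauge_space (dfjp_banach_disc cptB cvxB).
have mF := measurable_dfjp_space cptB cvxB.
have clB n : closed (dilate (n : nat)%:R B).
  by apply: compact_closed; [exact: norm_hausdorff|exact: compact_dilate].
have mB n : measurable (dilate (n : nat)%:R B : set (borel E)) by exact: closed_borel.
have [n _ Bn] : exists2 n, (0 <= n)%N & (mu (~` dilate n%:R B) <= (4^-1)%:E)%E.
  apply: (probability_exhaust mB) => //.
  by move=> n m nm; apply: dilate_le => //; rewrite ger0_norm// ler_nat.
have Bn34 : ((3 / 4)%:E <= mu (dilate n%:R B))%E.
  move: Bn; rewrite probability_setC// -[mu _]fineK ?fin_num_measure//.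
  by rewrite -EFinB !lee_fin; lra.
have absorbed h : rkhs mu h ->
    dilate (((rkhs_norm mu h ^+ 2 + 81) / 2 + 1) * n%:R) B h.
  move=> Hh; apply/dilateM; apply: rkhs_absorbed => //.
  exact: absolutely_convex_dilate.
exists (dfjp_space B); last first.
  move=> x /xsB Bx; apply: (@dilate_sub_dfjp_space _ _ _ _ 1) => //.
  by rewrite dilate1.
exists V, j; split; first by split=> //; exact: (dfjp_separable cptB cvxB jF j_norm).
split=> //.
- move=> h /absorbed; apply: dilate_sub_dfjp_space => //.
  by rewrite mulr_ge0// addr_ge0// divr_ge0// addr_ge0// sqr_ge0.
- apply/eqP; rewrite eq_le probability_le1//= -muB.
  apply: le_measure; [apply/mem_set|exact/mem_set|].
    exact: bigcupT_measurable.
  by move=> x [m _]; exact: dilate_sub_dfjp_space.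
- move=> A AH [M AM].
  pose t := ((M ^+ 2 + 81) / 2 + 1) * n%:R.
  have t0 : 0 <= t by rewrite mulr_ge0// addr_ge0// divr_ge0// addr_ge0// sqr_ge0.
  apply: (sub_compact_precompact (dfjp_preimage_compact cptB cvxB jF j_norm t0)).
  move=> v /= Av; apply: (dilate_le cvxB _ (absorbed _ (AH _ Av))).
  have N0 : 0 <= rkhs_norm mu (j v) by rewrite /rkhs_norm sqrtr_ge0.
  rewrite ger0_norm ?mulr_ge0 ?addr_ge0 ?divr_ge0 ?addr_ge0 ?sqr_ge0//.
  rewrite /t ler_wpM2r// lerD2r ler_pM2r// lerD2r lerXn2r ?AM//.
  by rewrite nnegrE (le_trans N0 (AM _ Av)).
- by move=> A; apply: (dfjp_bounded_precompact (B := B)).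
Qed.

Theorem mainTheorem3 (R : realType) (E : completeNormedModType R)
    (mu : probability (borel E) R)
    (Esep : separable_space E)
    (Einf : infinite_dimensional E)
    (muG : centered_gaussian mu) :
  infinite_set [set F : set E | intermediate_space mu F].
Proof.
move=> /finite_seqP[Fs FsE].
pose outside (F : set E) := xget 0 (~` F).
have [F intF xsF] := exists_intermediate_space [seq outside F | F <- Fs] Esep muG.
have FFs : F \in Fs by have : [set` Fs] F by rewrite -FsE.
have outF : F (outside F) by apply: xsF; exact: map_f.
(* As [F] contains [outside F], this point can only be the default 0, taken when the complement of
   [F] is empty. *)
apply: (intermediate_space_neq_setT Einf intF); apply/seteqP; split=> // x _.
apply: contrapT => Fx; move: outF; rewrite /outside.
by case: xgetP => [y _ Fy /Fy|/(_ x)].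
Qed.
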